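(* Let $F$ be a finite field with $\operatorname{char} F > 3$ and $|F| = q$, and let $sl_2(F)$ carry its natural $\mathbb{Z}_2$-grading. Then the $\mathbb{Z}_2$-graded polynomial identities of $sl_2(F)$ follow from $$[y_1,y_2],\quad Sem_1(y_1+z_1,\,y_2+z_2),\quad Sem_2(y_1+z_1,\,y_2+z_2),\quad [z_1,y_1^{q}] - [z_1,y_1];$$ that is, the ideal $Id_G(sl_2(F))$ of all $\mathbb{Z}_2$-graded identities of $sl_2(F)$ equals the graded verbal ideal $\langle S\rangle_T$ generated by the set $S$ of these four polynomials.
   Context: $G=\mathbb{Z}_2$. $sl_2(F)$ is the Lie algebra of traceless $2\times 2$ matrices over $F$; its natural grading has $sl_2(F)_0$ = diagonal traceless matrices $=F(e_{11}-e_{22})$ and $sl_2(F)_1$ = off-diagonal matrices $=Fe_{12}\oplus Fe_{21}$. Commutators are left-normed, $[a_1,\dots,a_n]=[[a_1,\dots,a_{n-1}],a_n]$, and $[a,b^k]=[a,b,\dots,b]$ with $b$ appearing $k$ times. $L(X)$ is the free Lie algebra over $F$ on even variables $y_1,y_2,\dots$ (degree $0$) and odd variables $z_1,z_2,\dots$ (degree $1$), with its natural $\mathbb{Z}_2$-grading. An element $f\in L(X)$ is a graded identity of a $\mathbb{Z}_2$-graded Lie algebra $L=L_0\oplus L_1$ if it vanishes under all substitutions of the $y_i$ by elements of $L_0$ and the $z_i$ by elements of $L_1$; $Id_G(L)$ is the set of graded identities of $L$. A graded verbal ideal is a graded ideal of $L(X)$ invariant under all graded endomorphisms; $\langle S\rangle_T$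 is the smallest graded verbal ideal containing $S$. The polynomials $Sem_1,Sem_2$: let $R_a$ denote the operator $v\mapsto [v,a]$, with operators written on the right and composed from left to right, and set $R_1=R_{x_1}$, $R_2=R_{x_2}$. Then $$Sem_1(x_1,x_2)=x_1\,(R_2^{q^2+2}-R_2^{3}),$$ $$Sem_2(x_1,x_2)=[x_1,x_2]-[x_1,x_2]R_1^{q^2-1}-x_1R_2^{q}+[x_1,x_2]R_1^{q^2-1}R_2^{q-1}+[x_1,x_2](R_1^{q^2}-R_1)R_{[x_1,x_2]}^{\,q-2}(R_2^{q^2}-R_2)-x_2\big((R_1^{q^2}-R_1)R_2-R_2(R_1^{q^2}-R_1)\big)^{q}(R_2^{q^2-2}-R_2^{q-2}).$$ *)

(* Defs.v *)
From HB Require Import structures.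
From mathcomp Require Import all_boot all_order all_algebra.
From mathcomp Require Import boolp classical_sets.

Set Implicit Arguments.
Unset Strict Implicit.
Unset Printing Implicit Defensive.

Import GRing.Theory.
Local Open Scope classical_set_scope.
Local Open Scope ring_scope.

HB.mixin Record Lmodule_isLie (F : fieldType) L of GRing.Lmodule F L := {
  lie : L -> L -> L;
  lie_linearl : forall (a : F) (x y z : L),
    lie (a *: x + y) z = a *: lie x z + lie y z;
  lie_linearr : forall (a : F) (x y z : L),
    lie z (a *: x + y) = a *: lie z x + lie z y;
  liexx : forall x : L, lie x x = 0;
  lie_jacobi : forall x y z : L,
    lie (lie x y) z + lie (lie y z) x + lie (lie z x) y = 0
}.

#[short(type="lieAlgType")]
HB.structure Definition LieAlgebra (F : fieldType) :=
  { L of Lmodule_isLie F L & GRing.Lmodule F L }.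

Notation "[l x , y ]" := (lie x y)
  (at level 0, x, y at level 99, format "[l  x ,  y ]") : ring_scope.

Definition is_subspace (F : fieldType) (V : lmodType F) (S : set V) : Prop :=
  S 0 /\ forall (a : F) (x y : V), S x -> S y -> S (a *: x + y).

HB.mixin Record Lie_isZ2Graded (F : fieldType) L of LieAlgebra F L := {
  component : 'Z_2 -> set L;
  component_subspace : forall g, is_subspace (component g);
  component_sum : forall x : L,
    exists x0 x1, [/\ component 0 x0, component 1 x1 & x = x0 + x1];
  component_direct : forall x : L, component 0 x -> component 1 x -> x = 0;
  component_lie : forall (g h : 'Z_2) (x y : L),
    component g x -> component h y -> component (g + h) [l x, y]
}.

#[short(type="gradedLieType")]
HB.structure Definition GradedLie (F : fieldType) :=
  { L of Lie_isZ2Graded F L & LieAlgebra F L }.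

Section LieTheory.
Variables (F : fieldType) (L : lieAlgType F).
Implicit Types x y z : L.

Lemma lieDl x y z : [l x + y, z] = [l x, z] + [l y, z].
Proof. by rewrite -[x]scale1r lie_linearl !scale1r. Qed.

Lemma lieDr x y z : [l z, x + y] = [l z, x] + [l z, y].
Proof. by rewrite -[x]scale1r lie_linearr !scale1r. Qed.

Lemma lie0l z : [l 0, z] = 0.
Proof. by apply: (addrI [l 0, z]); rewrite -lieDl !addr0. Qed.

Lemma lie0r z : [l z, 0] = 0.
Proof. by apply: (addrI [l z, 0]); rewrite -lieDr !addr0. Qed.

Lemma lieZl (a : F) x z : [l a *: x, z] = a *: [l x, z].
Proof. by rewrite -[a *: x]addr0 lie_linearl lie0l addr0. Qed.

Lemma lieZr (a : F) x z : [l z, a *: x] = a *: [l z, x].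
Proof. by rewrite -[a *: x]addr0 lie_linearr lie0r addr0. Qed.

End LieTheory.

Definition is_lie_hom (F : fieldType) (L M : lieAlgType F) (phi : L -> M) :=
  (forall (a : F) (x y : L), phi (a *: x + y) = a *: phi x + phi y) /\
  (forall x y : L, phi [l x, y] = [l phi x, phi y]).

(* The free Lie algebra on countably many even and odd variables is the quotient of the algebra of formal Lie
   expressions by the congruence generated by the axioms of Lie algebras; its
   universal property is proved below (eval_gen, eval_lie_hom, eval_uniq). *)

Inductive gvar := EvenVar of nat | OddVar of nat.

Definition vdeg (v : gvar) : 'Z_2 := if v is EvenVar _ then 0 else 1.

Inductive lterm (F : Type) :=
| TVar of gvar
| TZero
| TAdd of lterm F & lterm F
| TScale of F & lterm F
| TLie of lterm F & lterm F.
Arguments TVar {F}.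
Arguments TZero {F}.

HB.instance Definition _ (F : Type) := gen_eqMixin (lterm F).
HB.instance Definition _ (F : Type) := gen_choiceMixin (lterm F).

Inductive lcongr (F : fieldType) : lterm F -> lterm F -> Prop :=
| lcongr_refl t : lcongr t t
| lcongr_sym t u : lcongr t u -> lcongr u t
| lcongr_trans t u v : lcongr t u -> lcongr u v -> lcongr t v
| lcongr_add t t' u u' :
    lcongr t t' -> lcongr u u' -> lcongr (TAdd t u) (TAdd t' u')
| lcongr_scale a t t' : lcongr t t' -> lcongr (TScale a t) (TScale a t')
| lcongr_lie t t' u u' :
    lcongr t t' -> lcongr u u' -> lcongr (TLie t u) (TLie t' u')
| lcongr_addA t u v : lcongr (TAdd t (TAdd u v)) (TAdd (TAdd t u) v)
| lcongr_addC t u : lcongr (TAdd t u) (TAdd u t)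
| lcongr_add0 t : lcongr (TAdd TZero t) t
| lcongr_addN t : lcongr (TAdd (TScale (-1) t) t) TZero
| lcongr_scaleA a b t : lcongr (TScale a (TScale b t)) (TScale (a * b) t)
| lcongr_scale1 t : lcongr (TScale 1 t) t
| lcongr_scaleDr a t u :
    lcongr (TScale a (TAdd t u)) (TAdd (TScale a t) (TScale a u))
| lcongr_scaleDl a b t :
    lcongr (TScale (a + b) t) (TAdd (TScale a t) (TScale b t))
| lcongr_linl a t u v :
    lcongr (TLie (TAdd (TScale a t) u) v) (TAdd (TScale a (TLie t v)) (TLie u v))
| lcongr_linr a t u v :
    lcongr (TLie v (TAdd (TScale a t) u)) (TAdd (TScale a (TLie v t)) (TLie v u))
| lcongr_xx t : lcongr (TLie t t) TZero
| lcongr_jacobi t u v :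
    lcongr (TAdd (TAdd (TLie (TLie t u) v) (TLie (TLie u v) t))
                 (TLie (TLie v t) u)) TZero.

Section FreeLie.
Variable F : fieldType.

Definition lcongrb (t u : lterm F) : bool := `[< lcongr t u >].

Lemma lcongrb_equiv : equiv_class_of lcongrb.
Proof.
split=> [t|t u|u t v].
- by apply/asboolP; exact: lcongr_refl.
- by apply/asboolP/asboolP; exact: lcongr_sym.
- by move=> /asboolP tu /asboolP uv; apply/asboolP; exact: lcongr_trans tu uv.
Qed.

Canonical lcongr_equiv := EquivRelPack lcongrb_equiv.

Definition freeLie := {eq_quot lcongr_equiv}%qT.
HB.instance Definition _ := Choice.on freeLie.

Definition lclass (t : lterm F) : freeLie := (\pi_freeLie t)%qT.

Lemma lclassP t u : lclass t = lclass u <-> lcongr t u.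
Proof. by split=> [/eqquotP/asboolP|tu] //; apply/eqquotP/asboolP. Qed.

Lemma lclassK (f : freeLie) : lclass (repr f) = f.
Proof. exact: reprK. Qed.

Lemma repr_lclass t : lcongr (repr (lclass t)) t.
Proof. by apply/lclassP; rewrite lclassK. Qed.

Lemma lclassW (P : freeLie -> Prop) : (forall t, P (lclass t)) -> forall f, P f.
Proof. by move=> Pt f; rewrite -(lclassK f). Qed.

Definition fzero : freeLie := lclass TZero.
Definition fadd (f g : freeLie) : freeLie := lclass (TAdd (repr f) (repr g)).
Definition fscale (a : F) (f : freeLie) : freeLie := lclass (TScale a (repr f)).
Definition fopp (f : freeLie) : freeLie := fscale (-1) f.
Definition flie (f g : freeLie) : freeLie := lclass (TLie (repr f) (repr g)).

Lemma faddE t u : fadd (lclass t) (lclass u) = lclass (TAdd t u).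
Proof. by apply/lclassP; apply: lcongr_add; exact: repr_lclass. Qed.

Lemma fscaleE a t : fscale a (lclass t) = lclass (TScale a t).
Proof. by apply/lclassP; apply: lcongr_scale; exact: repr_lclass. Qed.

Lemma flieE t u : flie (lclass t) (lclass u) = lclass (TLie t u).
Proof. by apply/lclassP; apply: lcongr_lie; exact: repr_lclass. Qed.

Let opE := (faddE, fscaleE, flieE).

Lemma faddA : associative fadd.
Proof.
do 3!elim/lclassW=> ?; rewrite !opE; apply/lclassP; exact: lcongr_addA.
Qed.

Lemma faddC : commutative fadd.
Proof. do 2!elim/lclassW=> ?; rewrite !opE; apply/lclassP; exact: lcongr_addC. Qed.

Lemma fadd0 : left_id fzero fadd.
Proof. elim/lclassW=> ?; rewrite !opE; apply/lclassP; exact: lcongr_add0. Qed.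

Lemma faddN : left_inverse fzero fopp fadd.
Proof. elim/lclassW=> ?; rewrite /fopp !opE; apply/lclassP; exact: lcongr_addN. Qed.

HB.instance Definition _ := GRing.isZmodule.Build freeLie faddA faddC fadd0 faddN.

Lemma fscaleA a b f : fscale a (fscale b f) = fscale (a * b) f.
Proof. elim/lclassW: f => ?; rewrite !opE; apply/lclassP; exact: lcongr_scaleA. Qed.

Lemma fscale1 : left_id 1 fscale.
Proof. elim/lclassW=> ?; rewrite !opE; apply/lclassP; exact: lcongr_scale1. Qed.

Lemma fscaleDr : right_distributive fscale +%R.
Proof.
move=> a; do 2!elim/lclassW=> ?.
rewrite /GRing.add /= !opE; apply/lclassP; exact: lcongr_scaleDr.
Qed.

Lemma fscaleDl f : {morph fscale^~ f : a b / a + b}.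
Proof.
elim/lclassW: f => t a b.
rewrite [in RHS]/GRing.add /= !opE; apply/lclassP; exact: lcongr_scaleDl.
Qed.

HB.instance Definition _ :=
  GRing.Zmodule_isLmodule.Build F freeLie fscaleA fscale1 fscaleDr fscaleDl.

Lemma fzeroE : 0 = lclass TZero. Proof. by []. Qed.

Lemma addlE t u : lclass t + lclass u = lclass (TAdd t u).
Proof. exact: faddE. Qed.

Lemma scalelE a t : a *: lclass t = lclass (TScale a t).
Proof. exact: fscaleE. Qed.

Lemma flie_linl (a : F) (f g h : freeLie) :
  flie (a *: f + g) h = a *: flie f h + flie g h.
Proof.
elim/lclassW: f => t; elim/lclassW: g => u; elim/lclassW: h => v.
rewrite (flieE t) (flieE u) !scalelE (addlE _ u) flieE addlE.
by apply/lclassP; exact: lcongr_linl.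
Qed.

Lemma flie_linr (a : F) (f g h : freeLie) :
  flie h (a *: f + g) = a *: flie h f + flie h g.
Proof.
elim/lclassW: f => t; elim/lclassW: g => u; elim/lclassW: h => v.
rewrite (flieE v t) (flieE v u) !scalelE (addlE _ u) flieE addlE.
by apply/lclassP; exact: lcongr_linr.
Qed.

Lemma fliexx (f : freeLie) : flie f f = 0.
Proof. by elim/lclassW: f => t; rewrite flieE; apply/lclassP; exact: lcongr_xx. Qed.

Lemma flie_jacobi (f g h : freeLie) :
  flie (flie f g) h + flie (flie g h) f + flie (flie h f) g = 0.
Proof.
elim/lclassW: f => t; elim/lclassW: g => u; elim/lclassW: h => v.
rewrite (flieE t u) (flieE u v) (flieE v t) (flieE _ v) (flieE _ t) (flieE _ u).
by rewrite (addlE (TLie _ v)) addlE; apply/lclassP; exact: lcongr_jacobi.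
Qed.

HB.instance Definition _ :=
  Lmodule_isLie.Build F freeLie flie_linl flie_linr fliexx flie_jacobi.

Lemma lielE t u : [l lclass t, lclass u] = lclass (TLie t u).
Proof. exact: flieE. Qed.

Definition gen (v : gvar) : freeLie := lclass (TVar v).

Lemma freeLie_ind (P : freeLie -> Prop) :
  (forall v, P (gen v)) -> P 0 -> (forall f g, P f -> P g -> P (f + g)) ->
  (forall a f, P f -> P (a *: f)) -> (forall f g, P f -> P g -> P [l f, g]) ->
  forall f, P f.
Proof.
move=> Pv P0 PD PZ PL; elim/lclassW; elim=> [v||t Pt u Pu|a t Pt|t Pt u Pu].
- exact: Pv.
- exact: P0.
- by rewrite -addlE; exact: PD.
- by rewrite -scalelE; exact: PZ.
- by rewrite -lielE; exact: PL.
Qed.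

Section Eval.
Variables (L : lieAlgType F) (s : gvar -> L).

Fixpoint teval (t : lterm F) : L :=
  match t with
  | TVar v => s v
  | TZero => 0
  | TAdd t u => teval t + teval u
  | TScale a t => a *: teval t
  | TLie t u => [l teval t, teval u]
  end.

Definition eval (f : freeLie) : L := teval (repr f).

Lemma teval_congr t u : lcongr t u -> teval t = teval u.
Proof.
elim=> //= {t u}.
- by move=> t u v _ -> _ ->.
- by move=> t t' u u' _ -> _ ->.
- by move=> a t t' _ ->.
- by move=> t t' u u' _ -> _ ->.
- by move=> t u v; rewrite addrA.
- by move=> t u; rewrite addrC.
- by move=> t; rewrite add0r.
- by move=> t; rewrite scaleN1r addNr.
- by move=> a b t; rewrite scalerA.
- by move=> t; rewrite scale1r.
- by move=> a t u; rewrite scalerDr.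
- by move=> a b t; rewrite scalerDl.
- by move=> a t u v; rewrite lie_linearl.
- by move=> a t u v; rewrite lie_linearr.
- by move=> t; rewrite liexx.
- by move=> t u v; rewrite lie_jacobi.
Qed.

Lemma eval_lclass t : eval (lclass t) = teval t.
Proof. exact/teval_congr/repr_lclass. Qed.

Lemma eval_gen v : eval (gen v) = s v.
Proof. by rewrite eval_lclass. Qed.

Lemma eval_lie_hom : is_lie_hom eval.
Proof.
split=> [a|]; do 2!elim/lclassW=> ?.
- by rewrite scalelE addlE !eval_lclass.
- by rewrite lielE !eval_lclass.
Qed.

Lemma eval_uniq (phi : freeLie -> L) :
  is_lie_hom phi -> (forall v, phi (gen v) = s v) -> phi =1 eval.
Proof.
move=> [phiP phiL] phiv.
have [evP evL] := eval_lie_hom.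
have phi0 : phi 0 = 0.
  have := phiP (-1) 0 0.
  by rewrite scaler0 addr0 scaleN1r addNr.
have ev0 : eval 0 = 0.
  have := evP (-1) 0 0.
  by rewrite scaler0 addr0 scaleN1r addNr.
elim/freeLie_ind=> [v||f g fE gE|a f fE|f g fE gE].
- by rewrite phiv eval_gen.
- by rewrite phi0 ev0.
- by have := phiP 1 f g; have := evP 1 f g; rewrite !scale1r fE gE => -> ->.
- by have := phiP a f 0; have := evP a f 0; rewrite !addr0 fE phi0 ev0 !addr0 => -> ->.
- by rewrite phiL evL fE gE.
Qed.

End Eval.

Inductive fcomponent : 'Z_2 -> freeLie -> Prop :=
| fcomponent_gen v : fcomponent (vdeg v) (gen v)
| fcomponent0 g : fcomponent g 0
| fcomponent_lin g (a : F) f1 f2 :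
    fcomponent g f1 -> fcomponent g f2 -> fcomponent g (a *: f1 + f2)
| fcomponent_lie g h f1 f2 :
    fcomponent g f1 -> fcomponent h f2 -> fcomponent (g + h) [l f1, f2].

Lemma fcomponent_subspace g : is_subspace (fcomponent g).
Proof. by split=> [|a x y]; [exact: fcomponent0|exact: fcomponent_lin]. Qed.

Lemma fcomponentD g x y : fcomponent g x -> fcomponent g y -> fcomponent g (x + y).
Proof. by move=> xg yg; rewrite -[x]scale1r; exact: fcomponent_lin. Qed.

Lemma fcomponentZ g a x : fcomponent g x -> fcomponent g (a *: x).
Proof.
by move=> xg; rewrite -[_ *: _]addr0; apply: fcomponent_lin => //; exact: fcomponent0.
Qed.

Lemma fcomponent_sum f :
  exists f0 f1, [/\ fcomponent 0 f0, fcomponent 1 f1 & f = f0 + f1].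
Proof.
elim/freeLie_ind: f => [[i|i]||f g|a f|f g].
- exists (gen (EvenVar i)), 0; rewrite addr0; split=> //.
    exact: (fcomponent_gen (EvenVar i)).
  exact: fcomponent0.
- exists 0, (gen (OddVar i)); rewrite add0r; split=> //.
    exact: fcomponent0.
  exact: (fcomponent_gen (OddVar i)).
- by exists 0, 0; rewrite addr0; split=> //; exact: fcomponent0.
- move=> [f0 [f1 [f0P f1P ->]]] [g0 [g1 [g0P g1P ->]]].
  by exists (f0 + g0), (f1 + g1); rewrite addrACA; split=> //; exact: fcomponentD.
- move=> [f0 [f1 [f0P f1P ->]]].
  by exists (a *: f0), (a *: f1); rewrite scalerDr; split=> //; exact: fcomponentZ.
- move=> [f0 [f1 [f0P f1P ->]]] [g0 [g1 [g0P g1P ->]]].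
  exists ([l f0, g0] + [l f1, g1]), ([l f0, g1] + [l f1, g0]); split.
  + apply: fcomponentD; first by rewrite -(addr0 0); exact: fcomponent_lie.
    have <- : 1 + 1 = 0 :> 'Z_2 by exact: val_inj.
    exact: fcomponent_lie.
  + apply: fcomponentD; first by rewrite -(add0r 1); exact: fcomponent_lie.
    by rewrite -(addr0 1); exact: fcomponent_lie.
  + by rewrite lieDl !lieDr [X in _ + X = _]addrC addrACA.
Qed.

End FreeLie.

(* The tensor product of L with the group algebra of Z_2; mapping each free
   generator to its copy of the right degree separates the components of the
   free Lie algebra, in any characteristic. *)
Section Double.
Variables (F : fieldType) (L : lieAlgType F).

Lemma lieC (x y : L) : [l x, y] = - [l y, x].
Proof.
apply/eqP; rewrite -addr_eq0; apply/eqP.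
by have := liexx (x + y); rewrite lieDl !lieDr !liexx add0r addr0.
Qed.

Definition double := (L * L)%type.
HB.instance Definition _ := GRing.Lmodule.on double.

Definition dlie (x y : double) : double :=
  ([l x.1, y.1] + [l x.2, y.2], [l x.1, y.2] + [l x.2, y.1]).

Lemma dlie_linl (a : F) (x y z : double) :
  dlie (a *: x + y) z = a *: dlie x z + dlie y z.
Proof.
congr pair; rewrite /= !lie_linearl scalerDr; exact: addrACA.
Qed.

Lemma dlie_linr (a : F) (x y z : double) :
  dlie z (a *: x + y) = a *: dlie z x + dlie z y.
Proof.
congr pair; rewrite /= !lie_linearr scalerDr; exact: addrACA.
Qed.

Lemma dliexx (x : double) : dlie x x = 0.
Proof. by rewrite /dlie !liexx addr0 [[l x.1, x.2]]lieC addNr. Qed.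

Lemma dlie_jacobi (x y z : double) :
  dlie (dlie x y) z + dlie (dlie y z) x + dlie (dlie z x) y = 0.
Proof.
congr pair; rewrite /= !lieDl !addrA.
- rewrite (ACl ((1*5*9)*(2*8*11)*(3*6*12)*(4*7*10)))%AC /=.
  by rewrite !lie_jacobi !addr0.
- rewrite (ACl ((1*7*12)*(2*6*10)*(3*8*9)*(4*5*11)))%AC /=.
  by rewrite !lie_jacobi !addr0.
Qed.

HB.instance Definition _ :=
  Lmodule_isLie.Build F double dlie_linl dlie_linr dliexx dlie_jacobi.

Definition dinj (g : 'Z_2) (x : L) : double := if g == 0 then (x, 0) else (0, x).

Lemma Z2P (g : 'Z_2) : g = 0 \/ g = 1.
Proof. by case: g => [[|[|//]] gP]; [left|right]; apply: val_inj. Qed.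

Lemma dinj0 g : dinj g 0 = 0.
Proof. by rewrite /dinj; case: ifP. Qed.

Lemma dinj_lin g (a : F) x y : dinj g (a *: x + y) = a *: dinj g x + dinj g y.
Proof.
by rewrite /dinj; case: ifP => _; congr pair; rewrite /= scaler0 addr0.
Qed.

Lemma dinj_lie g h x y : dinj (g + h) [l x, y] = [l dinj g x, dinj h y].
Proof.
by case: (Z2P g) => ->; case: (Z2P h) => ->; congr pair => /=;
  rewrite /= ?lie0l ?lie0r ?addr0 ?add0r.
Qed.

End Double.

Section FreeLieGrading.
Variable F : fieldType.
Local Notation L := (freeLie F).

Definition fsplit : L -> double L := eval (fun v => dinj (vdeg v) (gen F v)).

Lemma fsplitE g (f : L) : fcomponent g f -> fsplit f = dinj g f.
Proof.
have [splitP splitL] := eval_lie_hom (fun v => dinj (vdeg v) (gen F v)).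
elim=> {g f} [v|g|g a f1 f2 _ E1 _ E2|g h f1 f2 _ E1 _ E2].
- exact: eval_gen.
- by rewrite dinj0 /fsplit /eval; exact: (eval_lclass _ TZero).
- by rewrite /fsplit splitP -!/(fsplit _) E1 E2 dinj_lin.
- by rewrite /fsplit splitL -!/(fsplit _) E1 E2 dinj_lie.
Qed.

Lemma fcomponent_direct (f : L) : fcomponent 0 f -> fcomponent 1 f -> f = 0.
Proof. by move=> /fsplitE f0 /fsplitE; rewrite f0 => -[]. Qed.

HB.instance Definition _ := Lie_isZ2Graded.Build F (freeLie F)
  (@fcomponent_subspace F) (@fcomponent_sum F) fcomponent_direct
  (@fcomponent_lie F).

End FreeLieGrading.

Section GradedIdentities.
Variable F : fieldType.

Definition is_graded_hom (L M : gradedLieType F) (phi : L -> M) : Prop :=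
  is_lie_hom phi /\
  forall (g : 'Z_2) (x : L), component g x -> component g (phi x).

Definition is_graded_ideal (L : gradedLieType F) (I : set L) : Prop :=
  [/\ is_subspace I,
      forall x y : L, I x -> I [l x, y] /\ I [l y, x] &
      forall x0 x1 : L, component 0 x0 -> component 1 x1 ->
        I (x0 + x1) -> I x0 /\ I x1].

Definition is_graded_verbal_ideal (I : set (freeLie F)) : Prop :=
  is_graded_ideal I /\
  forall phi : freeLie F -> freeLie F, is_graded_hom phi ->
    forall f, I f -> I (phi f).

Definition graded_verbal_hull (S : set (freeLie F)) : set (freeLie F) :=
  smallest is_graded_verbal_ideal S.

Definition graded_identities (L : gradedLieType F) : set (freeLie F) :=
  [set f | forall s : gvar -> L,
     (forall v, component (vdeg v) (s v)) -> eval s f = 0].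

End GradedIdentities.

Section Sl2.
Variable F : fieldType.

Definition traceless : {pred 'M[F]_2} := fun A => \tr A == 0.

Lemma traceless_submod : submod_closed traceless.
Proof.
split=> [|a A B]; rewrite ?unfold_in ?mxtrace0 // => /eqP A0 /eqP B0.
by rewrite mxtraceD mxtraceZ A0 B0 mulr0 addr0.
Qed.

HB.instance Definition _ :=
  GRing.isSubmodClosed.Build F 'M[F]_2 traceless traceless_submod.

Record sl2 := Sl2 { sl2_mx :> 'M[F]_2; sl2_traceless : sl2_mx \in traceless }.

HB.instance Definition _ := [isSub for sl2_mx].
HB.instance Definition _ := [Choice of sl2 by <:].
HB.instance Definition _ := [SubChoice_isSubLmodule of sl2 by <:].

Lemma sl2_lie_traceless (A B : sl2) : A *m B - B *m A \in traceless.
Proof. by rewrite unfold_in raddfB /= mxtrace_mulC subrr. Qed.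

Definition sl2_lie (A B : sl2) : sl2 := Sl2 (sl2_lie_traceless A B).

Lemma sl2_lie_linl (a : F) (A B C : sl2) :
  sl2_lie (a *: A + B) C = a *: sl2_lie A C + sl2_lie B C.
Proof.
apply: val_inj; rewrite /= mulmxDl mulmxDr -scalemxAl -scalemxAr scalerBr.
by rewrite opprD addrACA.
Qed.

Lemma sl2_lie_linr (a : F) (A B C : sl2) :
  sl2_lie C (a *: A + B) = a *: sl2_lie C A + sl2_lie C B.
Proof.
apply: val_inj; rewrite /= mulmxDl mulmxDr -scalemxAl -scalemxAr scalerBr.
by rewrite opprD addrACA.
Qed.

Lemma sl2_liexx (A : sl2) : sl2_lie A A = 0.
Proof. by apply: val_inj; rewrite /= subrr. Qed.

Lemma sl2_lie_jacobi (A B C : sl2) :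
  sl2_lie (sl2_lie A B) C + sl2_lie (sl2_lie B C) A + sl2_lie (sl2_lie C A) B = 0.
Proof.
apply: val_inj => /=; rewrite !mulmxBl !mulmxBr !mulmxA !opprB !addrA.
rewrite (ACl ((1*8)*(2*11)*(3*6)*(4*9)*(5*12)*(7*10)))%AC /=.
by rewrite ?(subrr, addNr, addr0).
Qed.

HB.instance Definition _ :=
  Lmodule_isLie.Build F sl2 sl2_lie_linl sl2_lie_linr sl2_liexx sl2_lie_jacobi.

Definition sl2_component (g : 'Z_2) : set sl2 :=
  if g == 0 then [set A : sl2 | is_diag_mx A]
  else [set A : sl2 | forall i, (A : 'M[F]_2) i i = 0].


Lemma sl2_component_subspace g : is_subspace (sl2_component g).
Proof.
rewrite /sl2_component; case: ifP => _; split=> [|a A B] /=.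
- exact: mx0_is_diag.
- move=> /is_diag_mxP Ad /is_diag_mxP Bd; apply/is_diag_mxP => i j ij.
  by rewrite !mxE Ad // Bd // mulr0 addr0.
- by move=> i; rewrite mxE.
- by move=> A0 B0 i; rewrite !mxE A0 B0 mulr0 addr0.
Qed.

Definition diag_part (A : 'M[F]_2) : 'M[F]_2 := \matrix_(i, j) (A i j *+ (i == j)).

Lemma diag_part_traceless (A : sl2) : diag_part A \in traceless.
Proof.
rewrite unfold_in; have /eqP <- := sl2_traceless A.
by apply/eqP/eq_bigr => i _; rewrite !mxE eqxx.
Qed.

Lemma sl2_component_sum (A : sl2) :
  exists A0 A1, [/\ sl2_component 0 A0, sl2_component 1 A1 & A = A0 + A1].
Proof.
pose A0 := Sl2 (diag_part_traceless A).
exists A0, (A - A0); split; last by rewrite addrC subrK.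
- by apply/is_diag_mxP => i j ij; rewrite mxE (negPf (_ : i != j)).
- by move=> i; rewrite !mxE eqxx subrr.
Qed.

Lemma sl2_component_direct A : sl2_component 0 A -> sl2_component 1 A -> A = 0.
Proof.
move=> /is_diag_mxP Ad A0; apply/val_inj/matrixP => i j; rewrite [RHS]mxE.
by have [<-|ij] := eqVneq i j; [exact: A0|exact: Ad].
Qed.

Lemma sl2_component_entries g A :
  sl2_component g A <-> forall i j : 'I_2, (i == j) != (g == 0) -> A i j = 0.
Proof.
rewrite /sl2_component; case: ifP => _; split=> [|Az] /=.
- by move=> /is_diag_mxP Ad i j; rewrite eqb_id; exact: Ad.
- by apply/is_diag_mxP => i j ij; apply: Az; rewrite eqb_id.
- by move=> A0 i j; have [->|] := eqVneq i j.
- by move=> i; apply: Az; rewrite eqxx.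
Qed.

Lemma sl2_component_mul g h A B (i j k : 'I_2) :
  sl2_component g A -> sl2_component h B ->
  (i == j) != (g + h == 0) -> A i k * B k j = 0.
Proof.
move=> /sl2_component_entries Ag /sl2_component_entries Bh.
have -> : (g + h == 0) = ((g == 0) == (h == 0)).
  by case: (Z2P g) => ->; case: (Z2P h) => ->.
have -> : (i == j) = ((i == k) == (k == j)).
  by case: (Z2P i) => ->; case: (Z2P j) => ->; case: (Z2P k) => ->.
have [Ez|/Ag ->] := eqVneq (i == k) (g == 0); last by rewrite mul0r.
have [Ez'|/Bh ->] := eqVneq (k == j) (h == 0); last by rewrite mulr0.
by rewrite Ez Ez' eqxx.
Qed.

Lemma sl2_component_lie g h A B : sl2_component g A -> sl2_component h B ->
  sl2_component (g + h) (sl2_lie A B).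
Proof.
move=> Ag Bh; apply/sl2_component_entries => i j ij.
rewrite !mxE -sumrB big1 // => k _.
have ji : (i == j) != (h + g == 0) by rewrite addrC.
by rewrite (sl2_component_mul k Ag Bh ij) (sl2_component_mul k Bh Ag ji) subrr.
Qed.

HB.instance Definition _ := Lie_isZ2Graded.Build F sl2
  sl2_component_subspace sl2_component_sum sl2_component_direct
  sl2_component_lie.

End Sl2.

Section Semenov.
Variables (F : fieldType) (L : lieAlgType F).

Definition Rop (a v : L) : L := [l v, a].

(* Operators are composed from left to right: (f \; g) v = g (f v). *)
Local Notation "f ^\; n" := (iter n f) (at level 30, n at level 29).

Definition Sem1 (q : nat) (x1 x2 : L) : L :=
  let R2 := Rop x2 in (R2 ^\; (q ^ 2 + 2) \- R2 ^\; 3) x1.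

Definition Sem2 (q : nat) (x1 x2 : L) : L :=
  let R1 := Rop x1 in
  let R2 := Rop x2 in
  let c := [l x1, x2] in
  let D1 := R1 ^\; (q ^ 2) \- R1 in
  c - (R1 ^\; (q ^ 2 - 1)) c - (R2 ^\; q) x1
  + (R1 ^\; (q ^ 2 - 1) \; R2 ^\; (q - 1)) c
  + (D1 \; (Rop c) ^\; (q - 2) \; (R2 ^\; (q ^ 2) \- R2)) c
  - (((D1 \; R2) \- (R2 \; D1)) ^\; q
     \; (R2 ^\; (q ^ 2 - 2) \- R2 ^\; (q - 2))) x2.

End Semenov.

Section Basis.
Variables (F : finFieldType).

Definition y_ (i : nat) : freeLie F := gen F (EvenVar i).
Definition z_ (i : nat) : freeLie F := gen F (OddVar i).

Definition sl2_basis : set (freeLie F) :=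
  let q := #|F| in
  [set [l y_ 1, y_ 2];
       Sem1 q (y_ 1 + z_ 1) (y_ 2 + z_ 2);
       Sem2 q (y_ 1 + z_ 1) (y_ 2 + z_ 2);
       iter q (Rop (y_ 1)) (z_ 1) - [l z_ 1, y_ 1]].

End Basis.
Arguments sl2_basis F : clear implicits.

(* Main.v *)
From HB Require Import structures.
Require Import Defs.
From mathcomp Require Import all_boot all_order all_algebra.
From mathcomp Require Import pgroup abelian finfield.
From mathcomp Require Import boolp classical_sets.
From mathcomp Require Import zify ring.
Import GRing.Theory.
Local Open Scope classical_set_scope.
Local Open Scope ring_scope.

Set Implicit Arguments.
Unset Strict Implicit.
Unset Printing Implicit Defensive.

(** Write L for the free Lie algebra, q for the order of F, and I for the graded
    verbal ideal generated by the four polynomials.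

    The graded identities of any graded Lie algebra form a graded verbal ideal,
    so for one inclusion only the four generators have to be evaluated in sl2.
    For the two Semenov polynomials everything follows from
    [[v, x], x] = (x, x) v - (v, x) x, where (x, y) is twice the trace of x y
    ([lie_lie_sl2]): it gives (ad x)^3 = (x, x) ad x, hence all powers of ad x,
    and (x, x)^(q-1) is 0 or 1.  What remains is a case distinction on which of
    x, y are nilpotent ([Sem1_sl2], [Sem2_sl2]).

    For the other inclusion let N be a quotient of L by a graded ideal that
    contains I.  In N even elements commute, every even a acts on the odd part
    with a^q = a, hence diagonalizably over F, and, by the second Semenov
    polynomial, two odd elements commute as soon as their bracket commutes with
    both of them.  An identity f of sl2 may be assumed homogeneous.

    Let f be odd and suppose that f is not in I.  Choose J maximal among the
    graded ideals containing I but not f; then every nonzero graded ideal of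
    N = L / J contains the image of f.  An operator T on the odd part which is
    self-adjoint for the bracket, commutes with the even part and satisfies
    T^q = T must be a scalar, since otherwise the kernels of T - s and of
    1 - (T - s)^(q-1) produce two graded ideals with trivial odd intersection
    ([selfadjoint_scalar]).  This applies to the square of every even element
    and, by polarization, to the product of any two.  Therefore the even part of
    N is at most a line F h, where h acts with eigenvalues 1 and -1, and N is an
    odd line, a two-dimensional Borel algebra, or sl2 itself
    ([monolith_model]).  In each case N embeds in sl2, so some graded
    substitution in sl2 does not kill f.

    Let f be even.  For every odd z the identity [f, z] is odd, so it lies in I:
    f is central modulo I.  Evaluating at one even variable at a time shows that
    f is, modulo I, a sum of brackets of odd elements.  Such a sum c, if central,
    vanishes: for odd m, n, u, v and h = [m, n] the Jacobi identity yields
    [h^2 u, v] = [[u, v] h m, n] ([lie_pluecker]), where even elements act on odd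
    ones; summing over the brackets in c replaces [u, v] by c, which acts as
    zero.  Combined with [m, n] = [h^(q-1) m, n] ([lie_odd_proj]) this removes
    the brackets of c one at a time ([central_derived_eq0]). *)

(** * Brackets, homomorphisms and gradings *)

Section LieBrackets.
Variables (F : fieldType) (L : lieAlgType F).
Implicit Types x y z : L.

Lemma RopZ (a : F) x z : Rop z (a *: x) = a *: Rop z x.
Proof. exact: lieZl. Qed.

Lemma Rop0 x : Rop x 0 = 0.
Proof. exact: lie0l. Qed.

Lemma iter_fix0 (f : L -> L) n : f 0 = 0 -> iter n f 0 = 0.
Proof. by move=> f0; elim: n => //= n ->. Qed.

Lemma lieNl x z : [l - x, z] = - [l x, z].
Proof. by rewrite -scaleN1r lieZl scaleN1r. Qed.
Lemma lieNr x z : [l z, - x] = - [l z, x].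
Proof. by rewrite -scaleN1r lieZr scaleN1r. Qed.
Lemma lieBl x y z : [l x - y, z] = [l x, z] - [l y, z].
Proof. by rewrite lieDl lieNl. Qed.
Lemma lieBr x y z : [l z, x - y] = [l z, x] - [l z, y].
Proof. by rewrite lieDr lieNr. Qed.

Lemma RopB z x y : Rop z (x - y) = Rop z x - Rop z y.
Proof. exact: lieBl. Qed.

Lemma iter_RopB z x y n :
  iter n (Rop z) (x - y) = iter n (Rop z) x - iter n (Rop z) y.
Proof. by elim: n => //= n ->; apply: RopB. Qed.

Lemma lie_lier x y z : [l [l x, y], z] = [l [l x, z], y] + [l x, [l y, z]].
Proof.
have := lie_jacobi x y z; rewrite [[l [l y, z], x]]lieC [[l z, x]]lieC lieNl.
by move=> /eqP; rewrite -addrA -opprD subr_eq0 => /eqP ->; rewrite addrC.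
Qed.

Lemma lie_bracket x y z : [l x, [l y, z]] = [l [l x, y], z] - [l [l x, z], y].
Proof. by rewrite (lie_lier x y z) addrC addKr. Qed.

(** The operator R_a^(q^2) - R_a of the second Semenov polynomial; naming it, and
    next its commutator with R_b, keeps the fifth and sixth terms readable. *)
Definition frob_defect (q : nat) (a v : L) : L := iter (q ^ 2) (Rop a) v - Rop a v.

Definition frob_defect_comm (q : nat) (a b v : L) : L :=
  Rop b (frob_defect q a v) - frob_defect q a (Rop b v).

Lemma Sem1E q x y : Sem1 q x y = iter (q ^ 2 + 2) (Rop y) x - iter 3 (Rop y) x.
Proof. by []. Qed.

Lemma Sem2E q x y : Sem2 q x y =
  [l x, y] - iter (q ^ 2 - 1) (Rop x) [l x, y] - iter q (Rop y) x
  + iter (q - 1) (Rop y) (iter (q ^ 2 - 1) (Rop x) [l x, y])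
  + frob_defect q y (iter (q - 2) (Rop [l x, y]) (frob_defect q x [l x, y]))
  - (iter (q ^ 2 - 2) (Rop y) (iter q (frob_defect_comm q x y) y)
     - iter (q - 2) (Rop y) (iter q (frob_defect_comm q x y) y)).
Proof. by []. Qed.

End LieBrackets.

Section LieHom.
Variables (F : fieldType) (L M : lieAlgType F) (phi : L -> M).
Hypothesis hphi : is_lie_hom phi.

Lemma lie_hom0 : phi 0 = 0.
Proof. by have := hphi.1 (-1) 0 0; rewrite scaler0 addr0 scaleN1r addNr. Qed.
Lemma lie_homD x y : phi (x + y) = phi x + phi y.
Proof. by have := hphi.1 1 x y; rewrite !scale1r. Qed.
Lemma lie_homZ a x : phi (a *: x) = a *: phi x.
Proof. by have := hphi.1 a x 0; rewrite lie_hom0 !addr0. Qed.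
Lemma lie_homN x : phi (- x) = - phi x.
Proof. by rewrite -scaleN1r lie_homZ scaleN1r. Qed.
Lemma lie_homB x y : phi (x - y) = phi x - phi y.
Proof. by rewrite lie_homD lie_homN. Qed.

Lemma lie_hom_iter_Rop x y n :
  phi (iter n (Rop y) x) = iter n (Rop (phi y)) (phi x).
Proof. by elim: n => //= n IHn; rewrite -IHn; exact: hphi.2. Qed.

Lemma lie_hom_Sem1 q x y : phi (Sem1 q x y) = Sem1 q (phi x) (phi y).
Proof. by rewrite !Sem1E lie_homB !lie_hom_iter_Rop. Qed.

Lemma lie_hom_Sem2 q x y : phi (Sem2 q x y) = Sem2 q (phi x) (phi y).
Proof.
have DE a v : phi (frob_defect q a v) = frob_defect q (phi a) (phi v).
  by rewrite lie_homB lie_hom_iter_Rop [phi (Rop _ _)]hphi.2.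
have WE n v : phi (iter n (frob_defect_comm q x y) v) =
    iter n (frob_defect_comm q (phi x) (phi y)) (phi v).
  elim: n => [//|n IHn]; rewrite !iterS -IHn {1}/frob_defect_comm lie_homB.
  by rewrite [phi (Rop _ _)]hphi.2 !DE [phi (Rop _ _)]hphi.2.
rewrite !Sem2E -!hphi.2.
by rewrite !(lie_homN, lie_homD, lie_hom_iter_Rop, DE, WE, hphi.2).
Qed.

End LieHom.

Section Graded.
Variables (F : fieldType) (L : gradedLieType F).
Implicit Types x y : L.

Lemma component0 g : component g (0 : L).
Proof. exact: (component_subspace g).1. Qed.
Lemma componentD g x y : component g x -> component g y -> component g (x + y).
Proof. by move=> xg yg; rewrite -[x]scale1r; apply: (component_subspace g).2. Qed.
Lemma componentZ g a x : component g x -> component g (a *: x).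
Proof.
by move=> xg; rewrite -[_ *: _]addr0; apply: (component_subspace g).2 => //; apply: component0.
Qed.
Lemma componentN g x : component g x -> component g (- x).
Proof. by rewrite -scaleN1r; apply: componentZ. Qed.
Lemma componentB g x y : component g x -> component g y -> component g (x - y).
Proof. by move=> xg yg; apply/componentD => //; apply/componentN. Qed.

Lemma lie_even_odd x y : component 0 x -> component 1 y -> component 1 [l x, y].
Proof. by move=> x0 y0; rewrite -[1]add0r; apply: component_lie. Qed.
Lemma lie_odd_even x y : component 1 x -> component 0 y -> component 1 [l x, y].
Proof. by move=> x0 y0; rewrite -[1]addr0; apply: component_lie. Qed.
Lemma lie_odd_odd x y : component 1 x -> component 1 y -> component 0 [l x, y].
Proof.
have <- : 1 + 1 = 0 :> 'Z_2 by exact: val_inj.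
exact: component_lie.
Qed.

Lemma component_add0 x0 x1 : component 0 x0 -> component 1 x1 ->
  x0 + x1 = 0 -> x0 = 0 /\ x1 = 0.
Proof.
move=> h0 h1 /eqP; rewrite addr_eq0 => /eqP e.
have x00 : x0 = 0 by apply: component_direct => //; rewrite e; apply: componentN.
by split=> //; rewrite -[x1]opprK -e x00 oppr0.
Qed.

Lemma component_uniq x0 x1 y0 y1 : component 0 x0 -> component 1 x1 ->
  component 0 y0 -> component 1 y1 -> x0 + x1 = y0 + y1 -> x0 = y0 /\ x1 = y1.
Proof.
move=> hx0 hx1 hy0 hy1 e; have [| | |e0 e1] := @component_add0 (x0 - y0) (x1 - y1).
- exact: componentB.
- exact: componentB.
- by rewrite addrACA -opprD e subrr.
by split; apply/eqP; rewrite -subr_eq0; apply/eqP.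
Qed.

Definition graded_subst (s : gvar -> L) := forall v, component (vdeg v) (s v).

Lemma eval_graded (s : gvar -> L) :
  graded_subst s -> is_graded_hom (eval s : freeLie F -> L).
Proof.
move=> sP; split=> [|g f]; first exact: eval_lie_hom.
elim=> {g f} [v|g|g a f1 f2 _ E1 _ E2|g h f1 f2 _ E1 _ E2].
- by rewrite eval_gen.
- by rewrite (lie_hom0 (eval_lie_hom s)); apply: component0.
- by rewrite (eval_lie_hom s).1; apply: (component_subspace g).2.
- by rewrite (eval_lie_hom s).2; apply: component_lie.
Qed.

(** Composing a graded substitution with a graded endomorphism of the free algebra
    is again evaluation at a graded substitution, which gives invariance. *)
Lemma identities_verbal : is_graded_verbal_ideal (graded_identities L).
Proof.
split; first split.
- split=> [s _|a x y hx hy s sP]; first exact: lie_hom0 (eval_lie_hom s).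
  by rewrite (eval_lie_hom s).1 hx // hy // scaler0 addr0.
- by move=> x y hx; split=> s sP; rewrite (eval_lie_hom s).2 hx // (lie0l, lie0r).
- move=> x0 x1 hx0 hx1 hx.
  have ev s : graded_subst s -> eval s x0 = 0 /\ eval s x1 = 0.
    move=> sP; have [hs gs] := eval_graded sP.
    by apply: component_add0; [exact: gs|exact: gs|rewrite -lie_homD // hx].
  by split=> s /ev [].
- move=> phi [hphi gphi] f hf s sP.
  have [hs gs] := eval_graded sP.
  have hsphi : is_lie_hom (eval s \o phi).
    by split=> [a x y|x y] /=; rewrite (hphi.1, hphi.2) (hs.1, hs.2).
  have /(_ f) /= -> := @eval_uniq _ _ (eval s \o phi \o gen F) _ hsphi (fun=> erefl).
  by apply: hf => v; apply/gs/gphi/fcomponent_gen.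
Qed.

End Graded.

(** * Quotients by graded ideals *)

Section Quotient.
Variables (F : fieldType) (L : gradedLieType F) (J : set L).
Hypothesis JP : is_graded_ideal J.

Lemma ideal0 : J 0. Proof. by case: JP => -[]. Qed.
Lemma ideal_lin a x y : J x -> J y -> J (a *: x + y).
Proof. by case: JP => -[_ + _ _]; apply. Qed.
Lemma idealD x y : J x -> J y -> J (x + y).
Proof. by move=> xJ yJ; rewrite -[x]scale1r; apply: ideal_lin. Qed.
Lemma idealZ a x : J x -> J (a *: x).
Proof. by move=> xJ; rewrite -[_ *: _]addr0; apply/ideal_lin/ideal0. Qed.
Lemma idealN x : J x -> J (- x).
Proof. by rewrite -scaleN1r; apply: idealZ. Qed.
Lemma ideal_liel x y : J x -> J [l x, y].
Proof. by case: JP => _ /(_ x y) + _ => /[apply] -[]. Qed.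
Lemma ideal_lier x y : J x -> J [l y, x].
Proof. by case: JP => _ /(_ x y) + _ => /[apply] -[]. Qed.

Definition eqmod (x y : L) : bool := `[< J (x - y) >].

Lemma eqmod_equiv : equiv_class_of eqmod.
Proof.
split=> [x|x y|y x z].
- by apply/asboolP; rewrite subrr; apply: ideal0.
- by apply/asboolP/asboolP => /idealN; rewrite opprB.
- move=> /asboolP xy /asboolP yz; apply/asboolP.
  by have := idealD xy yz; rewrite addrA subrK.
Qed.

Canonical eqmod_equivRel := EquivRelPack eqmod_equiv.

(** The quotient by J is built on canonical representatives; the grading of the
    quotient consists of the images of the components, and these meet trivially
    exactly because J is a graded ideal. *)
Definition lieQuot := {eq_quot eqmod_equivRel}%qT.
HB.instance Definition _ := Choice.on lieQuot.

Definition lpi (x : L) : lieQuot := (\pi_lieQuot x)%qT.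

Lemma lpiP x y : lpi x = lpi y <-> J (x - y).
Proof. by split=> [/eqquotP/asboolP|xy] //; apply/eqquotP/asboolP. Qed.

Lemma lpiK (u : lieQuot) : lpi (repr u) = u.
Proof. exact: reprK. Qed.

Lemma lpiW (P : lieQuot -> Prop) : (forall x, P (lpi x)) -> forall u, P u.
Proof. by move=> Px u; rewrite -(lpiK u). Qed.

Lemma repr_lpi x : J (repr (lpi x) - x).
Proof. by apply/lpiP; rewrite lpiK. Qed.

Definition qadd (u v : lieQuot) := lpi (repr u + repr v).
Definition qscale (a : F) (u : lieQuot) := lpi (a *: repr u).
Definition qopp (u : lieQuot) := lpi (- repr u).
Definition qlie (u v : lieQuot) := lpi [l repr u, repr v].

Lemma qaddE x y : qadd (lpi x) (lpi y) = lpi (x + y).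
Proof.
apply/lpiP; rewrite opprD addrACA; exact: idealD (repr_lpi x) (repr_lpi y).
Qed.
Lemma qscaleE a x : qscale a (lpi x) = lpi (a *: x).
Proof. by apply/lpiP; rewrite -scalerBr; exact: idealZ (repr_lpi x). Qed.
Lemma qoppE x : qopp (lpi x) = lpi (- x).
Proof. by apply/lpiP; rewrite -opprD; exact: idealN (repr_lpi x). Qed.
Lemma qlieE x y : qlie (lpi x) (lpi y) = lpi [l x, y].
Proof.
apply/lpiP; set x' := repr _; set y' := repr _.
have -> : [l x', y'] - [l x, y] = [l x' - x, y'] + [l x, y' - y].
  by rewrite lieBl lieBr addrA subrK.
by apply: idealD; [exact/ideal_liel/repr_lpi|exact/ideal_lier/repr_lpi].
Qed.

Let opE := (qaddE, qscaleE, qoppE, qlieE).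

Lemma qaddA : associative qadd.
Proof. by do 3!elim/lpiW=> ?; rewrite !opE addrA. Qed.
Lemma qaddC : commutative qadd.
Proof. by do 2!elim/lpiW=> ?; rewrite !opE addrC. Qed.
Lemma qadd0 : left_id (lpi 0) qadd.
Proof. by elim/lpiW=> ?; rewrite !opE add0r. Qed.
Lemma qaddN : left_inverse (lpi 0) qopp qadd.
Proof. by elim/lpiW=> ?; rewrite !opE addNr. Qed.

HB.instance Definition _ := GRing.isZmodule.Build lieQuot qaddA qaddC qadd0 qaddN.

Lemma lpiD x y : lpi (x + y) = lpi x + lpi y.
Proof. by rewrite -qaddE. Qed.

Lemma qscaleA a b u : qscale a (qscale b u) = qscale (a * b) u.
Proof. by elim/lpiW: u => ?; rewrite !opE scalerA. Qed.
Lemma qscale1 : left_id 1 qscale.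
Proof. by elim/lpiW=> ?; rewrite !opE scale1r. Qed.
Lemma qscaleDr : right_distributive qscale +%R.
Proof. by move=> a; do 2!elim/lpiW=> ?; rewrite -lpiD !opE scalerDr lpiD. Qed.
Lemma qscaleDl u : {morph qscale^~ u : a b / a + b}.
Proof. by elim/lpiW: u => ? a b; rewrite !opE scalerDl lpiD. Qed.

HB.instance Definition _ :=
  GRing.Zmodule_isLmodule.Build F lieQuot qscaleA qscale1 qscaleDr qscaleDl.

Lemma lpiZ a x : lpi (a *: x) = a *: lpi x.
Proof. by rewrite -qscaleE. Qed.

Lemma qlie_linl (a : F) (u v w : lieQuot) :
  qlie (a *: u + v) w = a *: qlie u w + qlie v w.
Proof.
elim/lpiW: u => x; elim/lpiW: v => y; elim/lpiW: w => z.
by rewrite -lpiZ -lpiD !qlieE -lpiZ -lpiD lie_linearl.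
Qed.
Lemma qlie_linr (a : F) (u v w : lieQuot) :
  qlie w (a *: u + v) = a *: qlie w u + qlie w v.
Proof.
elim/lpiW: u => x; elim/lpiW: v => y; elim/lpiW: w => z.
by rewrite -lpiZ -lpiD !qlieE -lpiZ -lpiD lie_linearr.
Qed.
Lemma qliexx (u : lieQuot) : qlie u u = 0.
Proof. by elim/lpiW: u => x; rewrite qlieE liexx. Qed.
Lemma qlie_jacobi (u v w : lieQuot) :
  qlie (qlie u v) w + qlie (qlie v w) u + qlie (qlie w u) v = 0.
Proof.
elim/lpiW: u => x; elim/lpiW: v => y; elim/lpiW: w => z.
by rewrite !qlieE -!lpiD lie_jacobi.
Qed.

HB.instance Definition _ :=
  Lmodule_isLie.Build F lieQuot qlie_linl qlie_linr qliexx qlie_jacobi.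

Lemma lpi_hom : is_lie_hom lpi.
Proof. by split=> [a x y|x y]; [rewrite lpiD lpiZ|rewrite -qlieE]. Qed.

Definition qcomponent (g : 'Z_2) (u : lieQuot) : Prop :=
  exists2 x, component g x & u = lpi x.

Lemma qcomponent_subspace g : is_subspace (qcomponent g).
Proof.
split=> [|a _ _ [x xg ->] [y yg ->]]; first by exists 0 => //; apply: component0.
by exists (a *: x + y); [apply: (component_subspace g).2|rewrite lpi_hom.1].
Qed.

Lemma qcomponent_sum u :
  exists u0 u1, [/\ qcomponent 0 u0, qcomponent 1 u1 & u = u0 + u1].
Proof.
elim/lpiW: u => x; have [x0 [x1 [h0 h1 ->]]] := component_sum x.
by exists (lpi x0), (lpi x1); split; [exists x0|exists x1|rewrite lpiD].
Qed.

Lemma qcomponent_direct u : qcomponent 0 u -> qcomponent 1 u -> u = 0.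
Proof.
move=> [x x0 ->] [y y1 /lpiP xy].
case: JP => _ _ /(_ x (- y) x0 (componentN y1) xy) [xJ _].
by apply/lpiP; rewrite subr0.
Qed.

Lemma qcomponent_lie (g h : 'Z_2) (u v : lieQuot) :
  qcomponent g u -> qcomponent h v -> qcomponent (g + h) [l u, v].
Proof.
move=> [x xg ->] [y yh ->].
by exists [l x, y]; [exact: component_lie|rewrite lpi_hom.2].
Qed.

HB.instance Definition _ := Lie_isZ2Graded.Build F lieQuot qcomponent_subspace
  qcomponent_sum qcomponent_direct qcomponent_lie.

Lemma lpi_eq0 x : lpi x = 0 <-> J x.
Proof. by rewrite (lpiP x 0) subr0. Qed.

Lemma lpi_component g x : component g x -> component g (lpi x).
Proof. by exists x. Qed.

End Quotient.

(** A graded substitution in the quotient lifts to one in the free algebra, and the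
    lifted evaluation is a graded endomorphism, under which I is stable. *)
Lemma verbal_quot_identities (F : fieldType) (I J : set (freeLie F))
    (JP : is_graded_ideal J) :
  is_graded_verbal_ideal I -> I `<=` J ->
  I `<=` graded_identities (lieQuot JP).
Proof.
move=> [_ IV] IJ f If s sP.
have /choice [t tP] : forall v, exists x, component (vdeg v) x /\ s v = lpi JP x.
  by move=> v; have [x] := sP v; exists x.
have tG : graded_subst t by move=> v; have [] := tP v.
have ht := eval_lie_hom t.
have hpt : is_lie_hom (lpi JP \o eval t).
  by split=> [a x y|x y] /=; rewrite (ht.1, ht.2) ((lpi_hom JP).1, (lpi_hom JP).2).
rewrite -(eval_uniq hpt) => [|v /=]; last by rewrite eval_gen; have [] := tP v.
by apply/lpi_eq0/IJ/IV => //; apply: eval_graded.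
Qed.

(** * Semenov's polynomials vanish on sl2 *)

Section Sl2Coordinates.
Variable F : fieldType.
Implicit Types x y v : sl2 F.

Lemma sl2_11 x : x 1 1 = - x 0 0.
Proof.
have /eqP := sl2_traceless x; rewrite /mxtrace !big_ord_recl big_ord0 addr0 => e.
apply/eqP; rewrite -addr_eq0 addrC; apply/eqP; rewrite -[RHS]e.
by congr (_ + x _ _); apply/val_inj.
Qed.

Lemma sl2_eq x y : x 0 0 = y 0 0 -> x 0 1 = y 0 1 -> x 1 0 = y 1 0 -> x = y.
Proof.
move=> e00 e01 e10; apply/val_inj/matrixP => i j /=.
by case: (Z2P i) => ->; case: (Z2P j) => ->; rewrite ?sl2_11 ?e00.
Qed.

Lemma mulmx2E (A B : 'M[F]_2) i j : (A *m B) i j = A i 0 * B 0 j + A i 1 * B 1 j.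
Proof.
rewrite !mxE !big_ord_recl big_ord0 addr0.
by congr (_ + A _ _ * B _ _); apply/val_inj.
Qed.

Lemma sl2_lieE x y (i j : 'I_2) : [l x, y] i j =
  x i 0 * y 0 j + x i 1 * y 1 j - (y i 0 * x 0 j + y i 1 * x 1 j).
Proof. by rewrite -!mulmx2E [LHS]mxE [X in _ + X]mxE. Qed.

Lemma sl2_addE x y (i j : 'I_2) : (x + y) i j = x i j + y i j.
Proof. by rewrite [LHS]mxE. Qed.
Lemma sl2_oppE x (i j : 'I_2) : (- x) i j = - x i j.
Proof. by rewrite [LHS]mxE. Qed.
Lemma sl2_scaleE a x (i j : 'I_2) : (a *: x) i j = a * x i j.
Proof. by rewrite [LHS]mxE. Qed.
Lemma sl2_0E (i j : 'I_2) : (0 : sl2 F) i j = 0.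
Proof. by rewrite [LHS]mxE. Qed.

Definition sl2E := (sl2_lieE, sl2_addE, sl2_oppE, sl2_scaleE, sl2_0E, sl2_11).

(** Twice the trace of the matrix product x y; with this normalization
    [trform x x] is the scalar by which (ad x)^2 acts on the image of ad x. *)
Definition trform x y : F :=
  2 * (2 * x 0 0 * y 0 0 + x 0 1 * y 1 0 + x 1 0 * y 0 1).

(** A form of Cayley-Hamilton: all powers of ad x on sl2 can be read off from it. *)
Lemma lie_lie_sl2 v x :
  [l [l v, x], x] = trform x x *: v - trform v x *: x.
Proof. by apply: sl2_eq; rewrite !sl2E /trform; ring. Qed.

Lemma trform_lie x y :
  trform [l x, y] [l x, y] = trform x y ^+ 2 - trform x x * trform y y.
Proof. by rewrite /trform !sl2E; ring. Qed.

Lemma trform_lier x y : trform y [l x, y] = 0.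
Proof. by rewrite /trform !sl2E; ring. Qed.

End Sl2Coordinates.

Section Soundness.
Variable F : finFieldType.
Implicit Types x y v : sl2 F.

Lemma Rop3_sl2 x v : Rop x (Rop x (Rop x v)) = trform x x *: Rop x v.
Proof.
by rewrite /Rop (lie_lie_sl2 v) lieBl !lieZl liexx scaler0 subr0.
Qed.

Lemma iter_Rop_odd x v k :
  iter k.*2.+1 (Rop x) v = trform x x ^+ k *: Rop x v.
Proof.
elim: k => [|k IHk]; first by rewrite scale1r.
by rewrite doubleS 2!iterS IHk !RopZ Rop3_sl2 scalerA -exprSr.
Qed.

Hypothesis two_neq0 : (2 : F) != 0.

Lemma trformE x y : trform x y = 0 ->
  2 * x 0 0 * y 0 0 + x 0 1 * y 1 0 + x 1 0 * y 0 1 = 0.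
Proof. by move/eqP; rewrite mulf_eq0 (negPf two_neq0) => /eqP. Qed.

Lemma trform_diag x : trform x x = 0 -> x 0 0 ^+ 2 = - (x 0 1 * x 1 0).
Proof.
move=> /trformE e; apply: (mulfI two_neq0).
by apply/eqP; rewrite -subr_eq0 -e; apply/eqP; ring.
Qed.

Lemma trformC x y : trform x y = trform y x.
Proof. by rewrite /trform; ring. Qed.

(** In characteristic other than 2 a totally isotropic subspace for the trace form
    on sl2 is at most a line. *)
Lemma isotropic_lie0 x y :
  trform x x = 0 -> trform y y = 0 -> trform x y = 0 -> [l x, y] = 0.
Proof.
move=> /trform_diag xx /trform_diag yy /trformE xy.
set a := x 0 0 in xx xy; set b := x 0 1 in xx xy; set c := x 1 0 in xx xy.
set A := y 0 0 in yy xy; set B := y 0 1 in yy xy; set C := y 1 0 in yy xy.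
have sq0 (u : F) : u ^+ 2 = 0 -> u = 0 by move/eqP; rewrite sqrf_eq0 => /eqP.
have e0 : b * C - c * B = 0.
  apply: sq0; transitivity ((2 * a * A + b * C + c * B) *
      (b * C + c * B - 2 * a * A) + 4 * (a ^+ 2 * A ^+ 2 - (b * c) * (B * C))).
    by ring.
  by rewrite xy xx yy; ring.
have e1 : a * B - b * A = 0.
  apply: sq0; transitivity (a ^+ 2 * B ^+ 2 + b ^+ 2 * A ^+ 2
      + b * B * (b * C + c * B) - b * B * (2 * a * A + b * C + c * B)).
    by ring.
  by rewrite xy xx yy; ring.
have e2 : c * A - a * C = 0.
  apply: sq0; transitivity (c ^+ 2 * A ^+ 2 + a ^+ 2 * C ^+ 2
      + c * C * (b * C + c * B) - c * C * (2 * a * A + b * C + c * B)).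
    by ring.
  by rewrite xy xx yy; ring.
by apply: sl2_eq; rewrite !sl2E -/a -/b -/c -/A -/B -/C;
  [rewrite -[RHS]e0|rewrite -[RHS](mulr0 2) -e1|rewrite -[RHS](mulr0 2) -e2]; ring.
Qed.

Lemma isotropic_lie0_colinear x y :
  trform x x = 0 -> x != 0 -> [l x, y] = 0 -> exists k, y = k *: x.
Proof.
move=> /trform_diag xx x0 xy.
have e0 : x 0 1 * y 1 0 - x 1 0 * y 0 1 = 0.
  by have := congr1 (fun z : sl2 F => z 0 0) xy; rewrite !sl2E => e; rewrite -e; ring.
have e1 : x 0 0 * y 0 1 - x 0 1 * y 0 0 = 0.
  apply: (mulfI two_neq0); rewrite mulr0.
  by have := congr1 (fun z : sl2 F => z 0 1) xy; rewrite !sl2E => e; rewrite -e; ring.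
have e2 : x 1 0 * y 0 0 - x 0 0 * y 1 0 = 0.
  apply: (mulfI two_neq0); rewrite mulr0.
  by have := congr1 (fun z : sl2 F => z 1 0) xy; rewrite !sl2E => e; rewrite -e; ring.
have solve (r s u v : F) : r != 0 -> r * s - u * v = 0 -> s = v / r * u.
  by move=> r0 /eqP; rewrite subr_eq0 => /eqP e; apply: (mulfI r0); rewrite e; field.
have [b0|b0] := eqVneq (x 0 1) 0; last first.
  exists (y 0 1 / x 0 1); apply: sl2_eq; rewrite !sl2E.
  - by apply: (solve _ _ _ _ b0); rewrite -opprB e1 oppr0.
  - by field.
  - exact: (solve _ _ _ _ b0 e0).
have [c0|c0] := eqVneq (x 1 0) 0; last first.
  exists (y 1 0 / x 1 0); apply: sl2_eq; rewrite !sl2E.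
  - exact: (solve _ _ _ _ c0 e2).
  - by apply: (solve _ _ _ _ c0); rewrite -opprB e0 oppr0.
  - by field.
case/eqP: x0; apply: sl2_eq; rewrite !sl2E //.
by move/eqP: xx; rewrite b0 mul0r oppr0 sqrf_eq0 => /eqP.
Qed.

(** An element orthogonal to a nonzero nilpotent x normalizes the line F x, so it
    lies in a Borel subalgebra and its eigenvalues are in F. *)
Lemma isotropic_perp_square x y : x != 0 -> trform x x = 0 -> trform x y = 0 ->
  exists k, trform y y = k ^+ 2.
Proof.
move=> x0 xx xy; have [k yx] : exists k, [l x, y] = k *: x.
  apply: isotropic_lie0_colinear => //.
  by rewrite [[l x, y]]lieC lieNr -lieC lie_lie_sl2 xx scale0r trformC xy scale0r subr0.
exists k; apply/eqP; rewrite -subr_eq0 -[_ == 0]orbF -(negPf x0).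
rewrite -scaler_eq0 scalerBl subr_eq0; apply/eqP.
have := lie_lie_sl2 x y; rewrite xy scale0r subr0 => <-.
by rewrite yx lieZl yx scalerA.
Qed.

Lemma Sem1_sl2 q x y : q = #|F| -> odd q -> Sem1 q x y = 0.
Proof.
move=> qF; move: (odd_double_half q) => /[swap] -> /=; rewrite add1n => qk.
set k := q./2 in qk.
rewrite Sem1E -[3%N]/(1.*2.+1)%N.
have -> : (q ^ 2 + 2 = ((k * k.+1).*2.+1).*2.+1)%N.
  by rewrite -qk; lia.
rewrite !iter_Rop_odd expr1 exprS.
have [->|d0] := eqVneq (trform y y) 0; first by rewrite !mul0r scale0r subr0.
have d1 : trform y y ^+ k.*2 = 1.
  by apply: (mulfI d0); rewrite -exprS qk qF expf_card mulr1.
have -> : ((k * k.+1).*2 = k.*2 * k.+1)%N by lia.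
by rewrite exprM d1 expr1n mulr1 subrr.
Qed.

(** If x is not nilpotent then (ad x)^(q^2) = ad x and the terms cancel in pairs.
    If x is nilpotent then the defect of ad x is - ad x, its commutator with ad y is
    - ad c for c = [x, y], and c is semisimple with eigenvalues in F unless x and y
    are orthogonal. *)
Lemma Sem2_sl2 q x y : q = #|F| -> odd q -> (3 < q)%N -> Sem2 q x y = 0.
Proof.
move=> qF q_odd q_gt3; have [k qk] : exists k, q = k.+2.*2.+1.
  exists q./2.-2; have := odd_double_half q; rewrite q_odd add1n => qk.
  by rewrite -qk; congr (_.*2.+1); lia.
have pow1 (d : F) : d != 0 -> d ^+ k.+2.*2 = 1.
  by move=> d0; apply: (mulfI d0); rewrite -exprS -qk qF expf_card mulr1.
have pow0 n : (0 : F) ^+ n.+1 = 0 by rewrite exprS mul0r.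
pose K := (k.+2 * k.+3).*2.-1.
have q2 : (q ^ 2 = K.+1.*2.+1)%N by rewrite qk /K; lia.
have q2_1 : (q ^ 2 - 1 = K.*2.+1.+1)%N by rewrite q2; lia.
have q2_2 : (q ^ 2 - 2 = K.*2.+1)%N by rewrite q2; lia.
have q_2 : (q - 2 = k.+1.*2.+1)%N by rewrite qk; lia.
have powK (d : F) : d != 0 -> d ^+ K.+1 = 1.
  have -> : (K.+1 = k.+2.*2 * k.+3)%N by rewrite /K; lia.
  by move=> d0; rewrite exprM pow1 // expr1n.
set c := [l x, y].
pose D := @frob_defect _ (sl2 F) q; pose W := frob_defect_comm q x y.
have DE z v : D z v = (trform z z ^+ K.+1 - 1) *: Rop z v.
  by rewrite /D /frob_defect q2 iter_Rop_odd scalerBl scale1r.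
rewrite Sem2E -/c -/D -/W.
have cx : c = Rop x (- y) by rewrite /c /Rop lieC lieNl.
have xq2 : iter (q ^ 2 - 1) (Rop x) c = trform x x ^+ K.+1 *: c.
  by rewrite q2_1 cx -iterSr -[K.*2.+2]/(K.+1.*2) iter_Rop_odd.
have yq : iter q (Rop y) x = trform y y ^+ k.+2 *: c.
  by rewrite qk iter_Rop_odd.
have yqc : iter (q - 1) (Rop y) c = trform y y ^+ k.+2 *: c.
  by rewrite -yq qk subn1 iterSr.
have [dx|dx] := eqVneq (trform x x) 0; last first.
(* (ad x)^(q^2) = ad x, and c lies in the image of ad x. *)
  have Dx v : D x v = 0 by rewrite DE powK // subrr scale0r.
  have -> : iter q W y = 0 by rewrite qk iterS /W /frob_defect_comm -/D !Dx Rop0 subrr.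
  rewrite xq2 powK // scale1r Dx !iter_fix0 ?Rop0 // DE Rop0 scaler0.
  by rewrite yqc yq !subrr sub0r addNr addr0 subr0.
have Dx v : D x v = - Rop x v by rewrite DE dx pow0 sub0r scaleN1r.
rewrite xq2 dx pow0 scale0r iter_fix0 ?Rop0 // subr0 addr0 yq Dx.
have WE v : W v = - [l v, c].
  rewrite /W /frob_defect_comm -/D !Dx /Rop lieNl opprK (lie_lier v x y).
  by rewrite opprD addrAC addNr add0r.
set b := trform x y.
have Wy : Rop y (W y) = trform y y *: c.
  by rewrite WE -lieC lie_lie_sl2 /Rop lieBl !lieZl liexx scaler0 subr0.
have cxE : Rop x c = b *: x.
  by rewrite /c lieC /Rop lieNl lie_lie_sl2 dx scale0r sub0r opprK trformC.
have dc : trform c c = b ^+ 2 by rewrite trform_lie dx mul0r subr0.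
have [dy|dy] := eqVneq (trform y y) 0.
(* Both nilpotent: c acts on the line F x as the scalar b, a square root of (c, c). *)
  rewrite q2_2 q_2 !iter_Rop_odd dy !pow0 !scale0r subrr !subr0.
  rewrite DE dy pow0 sub0r scaleN1r cxE.
  have [b0|b0] := eqVneq b 0.
    have -> : c = 0 by exact: isotropic_lie0.
    by rewrite b0 !scale0r oppr0 !Rop0 scaler0 Rop0 subr0.
  have -> : Rop c (- (b *: x)) = b ^+ 2 *: x.
    rewrite /Rop lieNl lieZl [[l x, c]]lieC scalerN opprK -/(Rop x c) cxE.
    by rewrite scalerA expr2.
  rewrite dc -exprM scalerA -exprD.
  have -> : (2 * k.+1 + 2 = k.+2.*2)%N by lia.
  by rewrite pow1 // scale1r subrr.
have -> v : D y v = 0 by rewrite DE powK // subrr scale0r.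
have WW : W (W y) = b ^+ 2 *: y.
  by rewrite !WE lieNl opprK lie_lie_sl2 trform_lier scale0r subr0 dc.
have Wq : iter q W y = b ^+ k.+2.*2 *: W y.
  rewrite qk; elim: (k.+2) => [|n IHn]; first by rewrite scale1r.
  have WZ a v : W (a *: v) = a *: W v by rewrite !WE lieZl scalerN.
  rewrite doubleS 2!iterS IHn !WZ -[n.*2.+2]addn2 exprD -scalerA; congr (_ *: _).
  by rewrite WW WZ.
rewrite addr0 q2_2 q_2 !iter_Rop_odd Wq RopZ Wy.
have [b0|b0] := eqVneq b 0; last first.
  by rewrite pow1 // scale1r !scalerA -!exprSr powK // scale1r subrr.
rewrite b0 pow0 scale0r !scaler0 !subr0.
have [x0|x0] := eqVneq x 0; first by rewrite /c x0 lie0l scaler0 subrr.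
have [t dt] := isotropic_perp_square x0 dx b0.
rewrite dt -exprM mul2n pow1 ?scale1r ?subrr //.
by apply: contra_neq dy => t0; rewrite dt t0 pow0.
Qed.

End Soundness.

(** * Central sums of brackets of odd elements *)

Section EvenOperators.
Variables (F : fieldType) (N : gradedLieType F).
Hypothesis two_neq0 : (2 : F) != 0.
Hypothesis even_lie : forall a b : N, component 0 a -> component 0 b -> [l a, b] = 0.
Local Notation even := (@component F N 0).
Local Notation odd := (@component F N 1).

Lemma odd_iter_Rop a m n : even a -> odd m -> odd (iter n (Rop a) m).
Proof. by move=> a0 m1; elim: n => //= n IHn; apply: lie_odd_even. Qed.

Lemma lie_evenAC m a b : even a -> even b -> [l [l m, a], b] = [l [l m, b], a].
Proof. by move=> a0 b0; rewrite lie_lier (even_lie a0 b0) lie0r addr0. Qed.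

(** Even elements are skew-adjoint for the bracket of odd elements, because that
    bracket is even and so commutes with them. *)
Lemma lie_odd_shift m n a : odd m -> odd n -> even a ->
  [l [l m, a], n] = - [l m, [l n, a]].
Proof.
move=> m1 n1 a0; apply/eqP; rewrite -addr_eq0 -lie_lier.
by apply/eqP/even_lie => //; apply: lie_odd_odd.
Qed.

Lemma lie_odd_shift2 m n a b : odd m -> odd n -> even a -> even b ->
  [l [l [l m, a], b], n] = [l m, [l [l n, b], a]].
Proof.
move=> m1 n1 a0 b0.
rewrite (lie_odd_shift (lie_odd_even m1 a0) n1 b0).
by rewrite (lie_odd_shift m1 (lie_odd_even n1 b0) a0) opprK.
Qed.

Lemma lie_odd_shift_iter m n a k : odd m -> odd n -> even a ->
  [l iter k.*2 (Rop a) m, n] = [l m, iter k.*2 (Rop a) n].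
Proof.
move=> m1 n1 a0; elim: k m m1 => [//|k IHk] m m1; rewrite doubleS 2!iterSr IHk.
  by rewrite lie_odd_shift2 //; apply: odd_iter_Rop.
by apply: lie_odd_even => //; apply: lie_odd_even.
Qed.

(** With even elements acting on odd ones, [h^2 u, v] = [[u, v] h m, n].  In sl2 the
    even part is a line and both sides say that h and [u, v] are proportional.  In
    general h u and h v are combinations of m and n by the Jacobi identity, and the
    coefficients satisfy the Pluecker relation among the brackets of m, n, u, v. *)
Lemma lie_pluecker m n u v : odd m -> odd n -> odd u -> odd v ->
  let h := [l m, n] in
  [l [l [l u, h], h], v] = [l [l [l m, h], [l u, v]], n].
Proof.
move=> m1 n1 u1 v1 h; have h0 : even h by apply: lie_odd_odd.
have g0 : even [l u, v] by apply: lie_odd_odd.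
set P := [l u, n]; set R := [l u, m]; set P' := [l v, n]; set R' := [l v, m].
have P0 : even P by apply: lie_odd_odd.
have R0 : even R by apply: lie_odd_odd.
have P0' : even P' by apply: lie_odd_odd.
have R0' : even R' by apply: lie_odd_odd.
have uh : [l u, h] = [l m, P] - [l n, R].
  by rewrite lie_bracket -/R -/P [[l R, n]]lieC [[l P, m]]lieC opprK addrC.
have vh : [l v, h] = [l m, P'] - [l n, R'].
  by rewrite lie_bracket -/R' -/P' [[l R', n]]lieC [[l P', m]]lieC opprK addrC.
have ng : [l n, [l u, v]] = [l v, P] - [l u, P'].
  rewrite lie_bracket [[l n, u]]lieC [[l n, v]]lieC !lieNl -/P -/P'.
  by rewrite [[l P, v]]lieC [[l P', u]]lieC !opprK.
have o : forall x a, odd x -> even a -> odd [l x, a] by exact: lie_odd_even.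
have isotropic z A B : odd z -> even A -> even B -> [l [l z, A], [l z, B]] = 0.
  move=> z1 A0 B0; have zA := o _ _ z1 A0; have zB := o _ _ z1 B0.
  have e : [l [l z, A], [l z, B]] = [l [l z, B], [l z, A]].
    by rewrite (lie_odd_shift z1 zB A0) (lie_odd_shift z1 zA B0) lie_evenAC.
  move/eqP: e; rewrite [X in _ == X]lieC -addr_eq0 -mulr2n -scaler_nat.
  by rewrite scaler_eq0 (negPf two_neq0) => /eqP.
rewrite (lie_odd_shift (o _ _ u1 h0) v1 h0) uh vh lieBl !lieBr !isotropic //.
rewrite sub0r subr0 opprD !opprK.
rewrite (lie_odd_shift2 m1 n1 h0 g0) ng.
rewrite lieBl [[l [l v, P], h]]lie_evenAC // [[l [l u, P'], h]]lie_evenAC //.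
rewrite uh vh !lieBl !lieBr (lie_evenAC m P0 P0') !opprB.
rewrite [[l [l n, R], _]]lieC (lie_odd_shift m1 (o _ _ n1 R0) P0').
rewrite (lie_odd_shift m1 (o _ _ n1 R0') P0) opprK.
by rewrite [RHS]addrC [RHS]addrA subrK addrC.
Qed.

Variable k : nat.
Hypothesis ad_pow : forall m a : N, odd m -> even a ->
  iter k.+1.*2.+1 (Rop a) m = [l m, a].
Hypothesis nil2_abelian : forall m n : N, odd m -> odd n ->
  [l [l m, n], m] = 0 -> [l [l m, n], n] = 0 -> [l m, n] = 0.

(** The idempotent e = h^(q-1) is self-adjoint.  The parts of m and n killed by e
    bracket to an element commuting with both, so [nil2_abelian] makes their
    bracket vanish. *)
Lemma lie_odd_proj m n : odd m -> odd n ->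
  [l iter k.+1.*2 (Rop [l m, n]) m, n] = [l m, n].
Proof.
move=> m1 n1; set h := [l m, n]; have h0 : even h by apply: lie_odd_odd.
pose e x := iter k.+1.*2 (Rop h) x.
have e1 x : odd x -> odd (e x) by apply: odd_iter_Rop.
have esym x y : odd x -> odd y -> [l e x, y] = [l x, e y].
  by move=> x1 y1; apply: lie_odd_shift_iter.
have he x : odd x -> [l x - e x, h] = 0.
  by move=> x1; rewrite lieBl -[[l e x, h]]/(iter k.+1.*2.+1 (Rop h) x) ad_pow // subrr.
have ee x : odd x -> e (x - e x) = 0.
  by move=> x1; rewrite /e doubleS iterSr [Rop h _]he // iter_fix0 ?Rop0.
have ekill x y : odd x -> odd y -> [l x - e x, e y] = 0.
  by move=> x1 y1; rewrite -esym ?ee ?lie0l //; apply/componentB/e1.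
have kill x y : odd x -> odd y -> [l x - e x, y] = [l x - e x, y - e y].
  by move=> x1 y1; rewrite lieBr ekill // subr0.
set m' := m - e m; set n' := n - e n.
have m'1 : odd m' by apply/componentB/e1.
have n'1 : odd n' by apply/componentB/e1.
(* [m', n'] = h - [e m, e n] kills m' and n' : h does, and e m, e n bracket to zero with them. *)
have z0 x : odd x -> [l [l m', n'], x - e x] = 0.
  move=> x1; rewrite /m' /n' -kill // lieBl lieBl [[l h, _]]lieC he // oppr0 sub0r.
  have -> : [l e m, n] = [l e m, e n].
    by apply/eqP; rewrite -subr_eq0 -lieBr lieC -[n - _]/n' -esym ?ee ?lie0l ?oppr0.
  rewrite lie_lier [[l e m, _]]lieC ekill // [[l e n, _]]lieC ekill //.
  by rewrite oppr0 lie0l lie0r addr0 oppr0.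
have : [l m', n'] = 0 by apply: nil2_abelian => //; apply: z0.
by rewrite /m' /n' -kill // lieBl => /eqP; rewrite subr_eq0 => /eqP.
Qed.

(** Summing the Pluecker relation over the brackets of a central element puts that
    element itself in the place of [u, v], where it acts as zero. *)
Lemma central_sum_pow (s : seq (N * N)) u v i :
  (forall p, p \in s -> odd p.1 /\ odd p.2) -> odd u -> odd v ->
  (forall x, odd x -> [l \sum_(p <- s) [l p.1, p.2], x] = 0) ->
  \sum_(p <- s) [l iter i.+1.*2 (Rop [l u, v]) p.1, p.2] = 0.
Proof.
move=> + u1 v1; have h0 : even [l u, v] by apply: lie_odd_odd.
have base r : (forall p, p \in r -> odd p.1 /\ odd p.2) ->
    (forall x, odd x -> [l \sum_(p <- r) [l p.1, p.2], x] = 0) ->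
    \sum_(p <- r) [l iter 2 (Rop [l u, v]) p.1, p.2] = 0.
  move=> r1 cr; transitivity [l [l [l u, [l u, v]], \sum_(p <- r) [l p.1, p.2]], v].
    elim: r r1 {cr} => [|p r IHr] r1; first by rewrite !big_nil lie0r lie0l.
    have [p1 p2] := r1 p (mem_head _ _); rewrite !big_cons lieDr lieDl IHr.
      by congr (_ + _); apply: lie_pluecker.
    by move=> t rt; apply: r1; rewrite in_cons rt orbT.
  by rewrite [[l [l u, _], _]]lieC cr ?oppr0 ?lie0l //; apply: lie_odd_even.
elim: i s => [|i IHi] s s1 cs; first exact: base.
pose f (p : N * N) := (iter 2 (Rop [l u, v]) p.1, p.2).
transitivity (\sum_(p <- map f s) [l iter i.+1.*2 (Rop [l u, v]) p.1, p.2]).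
  by rewrite big_map; apply: eq_bigr => p _; rewrite doubleS 2!iterSr.
apply: IHi => [_ /mapP[r /s1[r1 r2] ->]|x x1].
  by split=> //; apply: odd_iter_Rop.
by rewrite big_map base ?lie0l.
Qed.

(** The idempotent (ad h)^(q-1) for the first bracket h fixes that bracket and kills
    the whole sum, so its complement leaves a sum with fewer brackets. *)
Lemma central_derived_eq0 (s : seq (N * N)) :
  (forall p, p \in s -> odd p.1 /\ odd p.2) ->
  (forall x, odd x -> [l \sum_(p <- s) [l p.1, p.2], x] = 0) ->
  \sum_(p <- s) [l p.1, p.2] = 0.
Proof.
have [n] := ubnP (size s); elim: n s => // n IHn [|[u v] s].
  by rewrite big_nil.
rewrite /= ltnS => sn s1 cs; have [u1 v1] := s1 (u, v) (mem_head _ _).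
pose e x := iter k.+1.*2 (Rop [l u, v]) x.
pose f (p : N * N) := (p.1 - e p.1, p.2).
have sumE : \sum_(p <- (u, v) :: s) [l p.1, p.2] = \sum_(p <- map f s) [l p.1, p.2].
  have := central_sum_pow k s1 u1 v1 cs; rewrite big_cons lie_odd_proj // => e0.
  rewrite big_map -[LHS]subr0 -[X in _ - X]e0 big_cons opprD addrACA subrr add0r.
  by rewrite -sumrB; apply: eq_bigr => p _; rewrite lieBl.
rewrite sumE; apply: IHn; rewrite ?size_map //; last by rewrite -sumE.
move=> _ /mapP[p ps ->]; have [p1 p2] := s1 p (@mem_behead _ ((u, v) :: s) p ps).
by split=> //=; apply: componentB => //; apply: odd_iter_Rop; rewrite //; apply: lie_odd_odd.
Qed.

End EvenOperators.

(** * Operators equal to their q-th power *)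

Section PolyAction.
Variables (F : fieldType) (V : lmodType F) (T : V -> V).
Hypothesis Tlin : forall a x y, T (a *: x + y) = a *: T x + T y.
Implicit Types (p r : {poly F}) (x y : V).

(** The action of F[X] on V in which X acts as T; it gives access to the
    factorization of X^q - X and to the Frobenius morphism for operators. *)
Definition polyact (p : {poly F}) (x : V) : V :=
  \sum_(i < size p) p`_i *: iter i T x.

Lemma polyact_widen n p x : (size p <= n)%N ->
  polyact p x = \sum_(i < n) p`_i *: iter i T x.
Proof.
move=> pn; rewrite /polyact (big_ord_widen n (fun i => p`_i *: iter i T x)) //.
rewrite big_mkcond; apply: eq_bigr => i _; case: ltnP => // /leq_sizeP pi.
by rewrite pi ?scale0r.
Qed.

Lemma polyact_lin c p r x : polyact (c *: p + r) x = c *: polyact p x + polyact r x.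
Proof.
pose n := maxn (size (c *: p + r)) (maxn (size p) (size r)).
rewrite !(@polyact_widen n) ?leq_max ?leqnn ?orbT //.
rewrite scaler_sumr -big_split; apply: eq_bigr => i _ /=.
by rewrite coefD coefZ scalerDl scalerA.
Qed.

Lemma polyact_mulX p x : polyact (p * 'X) x = polyact p (T x).
Proof.
rewrite (@polyact_widen (size p).+1) ?size_mulX_leq //; last first.
  by have [->|p0] := eqVneq p 0; rewrite ?mul0r ?size_poly0 // size_mulX.
rewrite big_ord_recl coefMX eqxx scale0r add0r; apply: eq_bigr => i _.
by rewrite coefMX /= -iterS iterSr.
Qed.

Lemma iter_lin a x y n : iter n T (a *: x + y) = a *: iter n T x + iter n T y.
Proof. by elim: n => //= n ->; rewrite Tlin. Qed.

Lemma polyact_linr p a x y : polyact p (a *: x + y) = a *: polyact p x + polyact p y.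
Proof.
rewrite /polyact scaler_sumr -big_split; apply: eq_bigr => i _ /=.
by rewrite iter_lin scalerDr !scalerA mulrC.
Qed.

Lemma polyact_mul_root p t x :
  polyact (p * ('X - t%:P)) x = polyact p (T x - t *: x).
Proof.
have -> : p * ('X - t%:P) = - t *: p + p * 'X.
  by rewrite mulrBr addrC scaleNr -mul_polyC [_ * p]mulrC.
by rewrite polyact_lin polyact_mulX addrC -scaleNr [in RHS]addrC polyact_linr addrC.
Qed.

Lemma polyactX n x : polyact 'X^n x = iter n T x.
Proof.
elim: n x => [|n IHn] x; last by rewrite exprSr polyact_mulX IHn iterSr.
by rewrite expr0 /polyact size_poly1 big_ord1 coef1 scale1r.
Qed.

Lemma polyactC c x : polyact c%:P x = c *: x.
Proof.
by rewrite (polyact_widen x (size_polyC_leq1 c)) big_ord1 coefC.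
Qed.

Lemma polyact_shift_pow n t x :
  polyact (('X - t%:P) ^+ n) x = iter n (fun y => T y - t *: y) x.
Proof.
elim: n x => [|n IHn] x; first exact: (polyactX 0).
by rewrite exprSr polyact_mul_root IHn iterSr.
Qed.

Lemma polyact_split_eigen (rs : seq F) (P : V -> Prop) x :
  (forall y t, P y -> P (T y - t *: y)) -> P x -> x != 0 ->
  polyact (\prod_(t <- rs) ('X - t%:P)) x = 0 ->
  exists t v, [/\ P v, v != 0 & T v = t *: v].
Proof.
move=> PT; elim: rs x => [|t rs IHrs] x Px x0.
  by have /= xE := polyactX 0 x; rewrite big_nil xE => /eqP; rewrite (negPf x0).
rewrite big_cons mulrC polyact_mul_root.
have [e _|e] := eqVneq (T x - t *: x) 0; last by apply: IHrs; first exact: PT.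
by exists t, x; split=> //; apply/eqP; rewrite -subr_eq0 e.
Qed.

End PolyAction.

Section FinitePolyAction.
Variables (F : finFieldType) (V : lmodType F) (T : V -> V) (P : V -> Prop).
Hypothesis Tlin : forall a x y, T (a *: x + y) = a *: T x + T y.
Implicit Types (p r : {poly F}) (x y : V).
Hypothesis TP : forall y t, P y -> P (T y - t *: y).
Hypothesis TF : forall x, P x -> iter #|F| T x = T x.

(** X^q - X annihilates the vector and splits into linear factors over F. *)
Lemma frob_eigenvector x : P x -> x != 0 ->
  exists t v, [/\ P v, v != 0 & T v = t *: v].
Proof.
move=> Px x0; apply: (@polyact_split_eigen F V T Tlin (enum F) P x) => //.
rewrite big_enum -finField_genPoly addrC -scaleN1r polyact_lin.
by rewrite polyactX -['X]expr1 polyactX /= TF // scaleN1r addNr.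
Qed.

(** (X - t)^q = X^q - t in characteristic p, as t^q = t. *)
Lemma frob_shift t x : P x ->
  iter #|F| (fun y => T y - t *: y) x = T x - t *: x.
Proof.
move=> Px; rewrite -polyact_shift_pow //.
have [p _ pF] := finPcharP F.
have pq : [pchar {poly F}].-nat #|F|.
  rewrite (eq_pnat _ (pchar_poly F)) (eq_pnat _ (pcharf_eq pF)) -cardsT.
  exact/abelem_pgroup/fin_ring_pchar_abelem.
rewrite exprDn_pchar // -polyCN -rmorphXn /= expf_card.
by rewrite -['X^_]scale1r polyact_lin polyactX polyactC TF // scale1r scaleNr.
Qed.

End FinitePolyAction.

(** * Algebras modelled on subalgebras of sl2 *)

Section SpanTriples.
Variable F : fieldType.

(** The structure constants shared by the three algebras that occur: the odd line
    (c = b = 0), the Borel algebra (c = 1, b = 0) and sl2 (c = 1, b nonzero). *)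
Definition lie_table (L : lieAlgType F) (c b : F) (a m n : L) : Prop :=
  [/\ [l m, a] = c *: m, [l n, a] = - c *: n & [l m, n] = b *: a].

Definition lincomb (L : lieAlgType F) (a m n : L) (k : F * F * F) : L :=
  k.1.1 *: a + k.1.2 *: m + k.2 *: n.

Lemma lincomb_lin (L : lieAlgType F) (a m n : L) t k k' :
  lincomb a m n (t * k.1.1 + k'.1.1, t * k.1.2 + k'.1.2, t * k.2 + k'.2) =
  t *: lincomb a m n k + lincomb a m n k'.
Proof.
by rewrite /lincomb /= !scalerDr !scalerDl !scalerA [RHS]addrACA; congr (_ + _);
  rewrite addrACA.
Qed.

Lemma lincomb_lie (L : lieAlgType F) c b (a m n : L) k k' : lie_table c b a m n ->
  [l lincomb a m n k, lincomb a m n k'] =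
  lincomb a m n (b * (k.1.2 * k'.2 - k.2 * k'.1.2),
              c * (k.1.2 * k'.1.1 - k.1.1 * k'.1.2),
              c * (k.1.1 * k'.2 - k.2 * k'.1.1)).
Proof.
case: k k' => [[x y] z] [[x' y'] z'] [ma na mn]; rewrite /lincomb /=.
rewrite !lieDl !lieDr !lieZl !lieZr !liexx.
rewrite [[l a, m]]lieC [[l a, n]]lieC [[l n, m]]lieC ma na mn.
rewrite !scaler0 !add0r !addr0 ?scalerN !scalerA.
rewrite -!scaleNr !addrA (ACl ((4*6)*(1*3)*(2*5)))%AC /= -!scalerDl.
by congr (_ *: _ + _ *: _ + _ *: _); ring.
Qed.

(** N is spanned by an even a and odd m, n, with the same structure constants as
    a, m, n have for suitable elements A, E, E' of sl2.  The last clause says that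
    A, E, E' satisfy no linear relation that a, m, n do not: it allows n
    and E' to be zero together, which is how the smaller algebras are covered. *)
Definition sl2_model (N : gradedLieType F) (a m n : N) (A E E' : sl2 F) : Prop :=
  [/\ exists c b, lie_table c b a m n /\ lie_table c b A E E',
      [/\ component 0 a, component 1 m & component 1 n],
      [/\ component 0 A, component 1 E & component 1 E'],
      (forall x : N, component 0 x -> exists k, x = k *: a) /\
      (forall x : N, component 1 x -> exists k k', x = k *: m + k' *: n) &
      forall k, lincomb A E E' k = 0 -> lincomb a m n k = 0].

(** Pairs of corresponding combinations form a subalgebra of the product of N and
    sl2.  Matching the generators of the free algebra inside it, every f is sent to
    a corresponding pair, and the last clause of [sl2_model] applies. *)
Lemma sl2_model_subst (N : gradedLieType F) (a m n : N) (A E E' : sl2 F)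
    (pi : freeLie F -> N) :
  sl2_model a m n A E E' -> is_graded_hom pi ->
  exists s : gvar -> sl2 F, graded_subst s /\
    forall f, eval s f = 0 -> pi f = 0.
Proof.
move=> [[c [b [tN tS]]] _ [A0 E1 E1'] [span0 span1] inj] [hpi gpi].
pose Gam (x : N) (X : sl2 F) := exists k, x = lincomb a m n k /\ X = lincomb A E E' k.
have /choice [s sP] : forall v, exists X, component (vdeg v) X /\ Gam (pi (gen F v)) X.
  move=> v; have := gpi _ _ (fcomponent_gen F v); case: v => i /=.
    move=> /span0[k e]; exists (k *: A); split; first exact: componentZ.
    by exists (k, 0, 0); rewrite /lincomb /= !scale0r !addr0.
  move=> /span1[k [k' e]]; exists (k *: E + k' *: E'); split.
    by apply: componentD; apply: componentZ.
  by exists (0, k, k'); rewrite /lincomb /= !scale0r !add0r.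
exists s; split=> [v|f]; first by have [] := sP v.
suff [k [-> ->]] : Gam (pi f) (eval s f) by exact: inj.
have [evlin evlie] := eval_lie_hom s.
have Glin t x y X Y : Gam x X -> Gam y Y -> Gam (t *: x + y) (t *: X + Y).
  move=> [k [-> ->]] [k' [-> ->]].
  by exists (t * k.1.1 + k'.1.1, t * k.1.2 + k'.1.2, t * k.2 + k'.2); rewrite !lincomb_lin.
have G0 : Gam 0 0 by exists (0, 0, 0); rewrite /lincomb !scale0r !addr0.
elim/freeLie_ind: f => [v||f g Gf Gg|t f Gf|f g [k [fE fE']] [k' [gE gE']]].
- by rewrite eval_gen; have [] := sP v.
- by rewrite (lie_hom0 hpi) (lie_hom0 (eval_lie_hom s)).
- rewrite (lie_homD hpi) (lie_homD (eval_lie_hom s)).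
  by rewrite -[pi f]scale1r -[eval s f]scale1r; apply: Glin.
- rewrite (lie_homZ hpi) (lie_homZ (eval_lie_hom s)).
  by rewrite -[t *: pi f]addr0 -[t *: eval s f]addr0; apply: Glin.
- by rewrite hpi.2 evlie fE fE' gE gE' (lincomb_lie _ _ tN) (lincomb_lie _ _ tS); eexists.
Qed.

Lemma sl2_of_traceless (a b c : F) :
  \matrix_(i < 2, j < 2) (if i == 0 then if j == 0 then a else b
                          else if j == 0 then c else - a) \in @traceless F.
Proof.
by rewrite unfold_in /mxtrace !big_ord_recl big_ord0 !mxE /= addr0 subrr.
Qed.

Definition sl2_of a b c : sl2 F := Sl2 (sl2_of_traceless a b c).

Lemma sl2_of00 a b c : sl2_of a b c 0 0 = a. Proof. by rewrite mxE. Qed.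
Lemma sl2_of01 a b c : sl2_of a b c 0 1 = b. Proof. by rewrite mxE. Qed.
Lemma sl2_of10 a b c : sl2_of a b c 1 0 = c. Proof. by rewrite mxE. Qed.
Definition sl2_ofE := (sl2_of00, sl2_of01, sl2_of10).

Lemma sl2_of_even a : component 0 (sl2_of a 0 0).
Proof. by apply/is_diag_mxP => i j; case: (Z2P i) => ->; case: (Z2P j) => ->; rewrite mxE. Qed.

Lemma sl2_of_odd b c : component 1 (sl2_of 0 b c).
Proof. by move=> i; case: (Z2P i) => ->; rewrite mxE ?oppr0. Qed.

Lemma sl2_table b : (2 : F) != 0 ->
  lie_table 1 b (sl2_of (- 2^-1) 0 0) (sl2_of 0 1 0) (sl2_of 0 0 (- (b / 2))).
Proof.
move=> two0; split; apply: sl2_eq; rewrite !sl2E !sl2_ofE; by field.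
Qed.

Lemma lincomb_sl2 a m n k :
  let X := lincomb (sl2_of a 0 0) (sl2_of 0 m 0) (sl2_of 0 0 n) k in
  [/\ X 0 0 = k.1.1 * a, X 0 1 = k.1.2 * m & X 1 0 = k.2 * n].
Proof. by split; rewrite !sl2E !sl2_ofE ?(mulr0, addr0, add0r). Qed.

End SpanTriples.

(** * Graded algebras with an odd monolith *)

Section Monolith.
Variables (F : finFieldType) (N : gradedLieType F).
Local Notation even := (@component F N 0).
Local Notation odd := (@component F N 1).
Implicit Types (x y u v m n : N) (D T : N -> N) (s t : F).

Hypothesis two_neq0 : (2 : F) != 0.
Hypothesis card_gt1 : (1 < #|F|)%N.
Hypothesis even_lie : forall a b : N, even a -> even b -> [l a, b] = 0.
Hypothesis ad_pow : forall m a : N, odd m -> even a ->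
  iter #|F| (Rop a) m = [l m, a].
Variable g : N.
Hypothesis g1 : odd g.
Hypothesis g_neq0 : g != 0.
Hypothesis monolith : forall (K : set N) x,
  is_graded_ideal K -> K x -> x != 0 -> K g.

Lemma line_is_ideal d u : component d u ->
  (forall x, exists k, [l u, x] = k *: u) ->
  is_graded_ideal [set x | exists k, x = k *: u].
Proof.
move=> ud ux; split.
- split=> [|a _ _ [k ->] [k' ->]]; first by exists 0; rewrite scale0r.
  by exists (a * k + k'); rewrite scalerDl scalerA.
- move=> _ y [k ->]; have [k' e] := ux y; split.
    by exists (k * k'); rewrite lieZl e scalerA.
  by exists (- (k * k')); rewrite lieC lieZl e scaleNr scalerA.
- move=> x0 x1 h0 h1 [k e].
  case: (Z2P d) ud => -> ud.
    have [->->] : x0 = k *: u /\ x1 = 0.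
      apply: component_uniq => //; rewrite ?addr0 //; last exact: component0.
      exact: componentZ.
    by split; [exists k|exists 0; rewrite scale0r].
  have [->->] : x0 = 0 /\ x1 = k *: u.
    apply: component_uniq => //; rewrite ?add0r //; first exact: component0.
    exact: componentZ.
  by split; [exists 0; rewrite scale0r|exists k].
Qed.

Lemma monolith_line d u : component d u ->
  (forall x, exists k, [l u, x] = k *: u) -> u != 0 -> exists k, g = k *: u.
Proof.
move=> ud ux; apply: (monolith (line_is_ideal ud ux)).
by exists 1; rewrite scale1r.
Qed.

(** An even central element spans a graded ideal that cannot contain the odd g. *)
Lemma even_faithful c : even c -> (forall x, odd x -> [l x, c] = 0) -> c = 0.
Proof.
move=> c0 cx; have [//|cN0] := eqVneq c 0.
have [x|k gE] := monolith_line c0 _ cN0.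
  have [x0 [x1 [h0 h1 ->]]] := component_sum x.
  by exists 0; rewrite scale0r lieDr even_lie // [[l c, x1]]lieC cx // oppr0 addr0.
case/eqP: g_neq0; apply: component_direct => //.
by rewrite gE; apply: componentZ.
Qed.

(** The operators produced by even powers of even elements: linear, preserving the
    odd part, commuting with the even part, and self-adjoint for the bracket of odd
    elements. *)
Definition selfadjoint (T : N -> N) : Prop :=
  [/\ forall a x y, T (a *: x + y) = a *: T x + T y,
      forall x, odd x -> odd (T x),
      forall x a, odd x -> even a -> T [l x, a] = [l T x, a] &
      forall x y, odd x -> odd y -> [l T x, y] = [l x, T y]].

(** The elements on which D vanishes, in the odd part directly and in the even part
    through the action on odd elements.  Self-adjointness makes D^2 kill what has to
    be killed by D, whence the assumption that D is reduced. *)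
Lemma selfadjoint_kernel_ideal D : selfadjoint D ->
  (forall x, odd x -> D (D x) = 0 -> D x = 0) ->
  is_graded_ideal [set x | exists x0 x1, [/\ even x0, odd x1, x = x0 + x1,
    D x1 = 0 & forall y, odd y -> D [l y, x0] = 0]].
Proof.
move=> [Dlin Dodd Dlie Dsym] Dred; set K := [set _ | _].
have D0 : D 0 = 0 by have := Dlin (-1) 0 0; rewrite scaler0 addr0 scaleN1r addNr.
have DD x y : D (x + y) = D x + D y by have := Dlin 1 x y; rewrite !scale1r.
have DZ a x : D (a *: x) = a *: D x by have := Dlin a x 0; rewrite D0 !addr0.
have Ksub : is_subspace K.
  split=> [|a _ _ [x0 [x1 [h0 h1 -> Dx1 Dx0]]] [y0 [y1 [k0 k1 -> Dy1 Dy0]]]].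
    exists 0, 0; split; rewrite ?addr0 //; try exact: component0.
    by move=> y _; rewrite lie0r.
  exists (a *: x0 + y0), (a *: x1 + y1); split.
  - by apply: componentD => //; apply: componentZ.
  - by apply: componentD => //; apply: componentZ.
  - by rewrite scalerDr addrACA.
  - by rewrite Dlin Dx1 Dy1 scaler0 addr0.
  - by move=> y y1'; rewrite lie_linearr Dlin Dx0 // Dy0 // scaler0 addr0.
have Kl x y : K x -> K [l x, y].
  move=> [x0 [x1 [h0 h1 -> Dx1 Dx0]]]; have [y0 [y1 [k0 k1 ->]]] := component_sum y.
  exists [l x1, y1], ([l x0, y1] + [l x1, y0]); split.
  - exact: lie_odd_odd.
  - by apply: componentD; [apply: lie_even_odd|apply: lie_odd_even].
  - by rewrite lieDl !lieDr even_lie // add0r addrA addrC.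
  - by rewrite DD lieC -scaleN1r DZ Dx0 // scaler0 add0r Dlie // Dx1 lie0l.
  move=> z z1; have z0 := lie_odd_odd h1 k1.
  apply: Dred; first exact: lie_odd_even.
  (* D [z, [x1, y1]] = [D z, [x1, y1]] = [x1, [D z, y1]], as [D z, x1] = [z, D x1] = 0. *)
  rewrite Dlie // lie_bracket Dsym // Dx1 lie0r lie0l sub0r -lieC Dlie // ?Dx1 ?lie0l //.
  by apply: lie_odd_odd => //; apply: Dodd.
split=> //.
- move=> x y Kx; split; first exact: Kl.
  rewrite lieC -scaleN1r -[_ *: _]addr0; apply: Ksub.2; [exact: Kl|exact: Ksub.1].
- move=> x0 x1 h0 h1 [y0 [y1 [k0 k1 e Dy1 Dy0]]].
  have [-> ->] := component_uniq h0 h1 k0 k1 e; split.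
    by exists y0, 0; split; rewrite ?addr0 //; apply: component0.
  exists 0, y1; split; rewrite ?add0r //; first exact: component0.
  by move=> y _; rewrite lie0r.
Qed.

Lemma selfadjoint_monolith D v : selfadjoint D ->
  (forall x, odd x -> D (D x) = 0 -> D x = 0) ->
  odd v -> v != 0 -> D v = 0 -> D g = 0.
Proof.
move=> Dself Dred v1 v0 Dv; have [Dlin _ _ _] := Dself.
have [|g0 [g1' [h0 h1 e Dg _]]] := monolith (selfadjoint_kernel_ideal Dself Dred) _ v0.
  exists 0, v; split; rewrite ?add0r //; first exact: component0.
  move=> y _; rewrite lie0r; have := Dlin (-1) 0 0.
  by rewrite scaler0 addr0 scaleN1r addNr.
have [_ -> //] : 0 = g0 /\ g = g1'.
by apply: component_uniq => //; rewrite ?add0r //; apply: component0.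
Qed.

Lemma selfadjoint_comp T T' : selfadjoint T -> selfadjoint T' ->
  (forall x, odd x -> T (T' x) = T' (T x)) -> selfadjoint (T \o T').
Proof.
move=> [Tl To Tc Ts] [Tl' To' Tc' Ts'] TT'; split=> /=.
- by move=> a x y; rewrite Tl' Tl.
- by move=> x x1; apply/To/To'.
- by move=> x a x1 a0; rewrite Tc' ?Tc //; apply: To'.
- by move=> x y x1 y1; rewrite Ts ?Ts' ?TT' //; [apply: To|apply: To'].
Qed.

Lemma selfadjoint_iter T k : selfadjoint T -> selfadjoint (iter k T).
Proof.
move=> Tself; elim: k => [|k IHk]; first by split.
by apply: (selfadjoint_comp Tself IHk) => x _; rewrite -iterS iterSr.
Qed.

Lemma selfadjoint_lin T T' s t : selfadjoint T -> selfadjoint T' ->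
  selfadjoint (fun x => s *: T x + t *: T' x).
Proof.
move=> [Tl To Tc Ts] [Tl' To' Tc' Ts']; split.
- move=> a x y; rewrite Tl Tl' !scalerDr addrACA !scalerA.
  by rewrite [s * a]mulrC [t * a]mulrC.
- by move=> x x1; apply: componentD; apply: componentZ; [apply: To|apply: To'].
- by move=> x a x1 a0; rewrite Tc // Tc' // lieDl !lieZl.
- by move=> x y x1 y1; rewrite lieDl lieDr !lieZl !lieZr Ts // Ts'.
Qed.

Lemma selfadjoint_id : selfadjoint id.
Proof. by split. Qed.

(** D and the idempotent E = 1 - D^(q-1) are both reduced.  A kernel vector of D makes D
    vanish at g; a nonzero value of D is a kernel vector of E, so E would vanish at g
    as well, although g = E g + D^(q-1) g. *)
Lemma selfadjoint_pow_eq0 D v : selfadjoint D ->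
  (forall x, odd x -> iter #|F| D x = D x) ->
  odd v -> v != 0 -> D v = 0 -> forall x, odd x -> D x = 0.
Proof.
move=> Dself Dq v1 v0 Dv x x1; have [Dlin Dodd _ _] := Dself.
have D0 : D 0 = 0 by have := Dlin (-1) 0 0; rewrite scaler0 addr0 scaleN1r addNr.
have [k qk] : exists k, #|F| = k.+2 by exists #|F|.-2; lia.
have Dg : D g = 0.
  apply: (selfadjoint_monolith Dself _ v1 v0 Dv) => y y1 DDy.
  by rewrite -Dq // qk 2!iterSr DDy iter_fix0.
pose E x := 1 *: x + (- 1) *: iter k.+1 D x.
have Eself : selfadjoint E.
  by apply: selfadjoint_lin; [exact: selfadjoint_id|exact: selfadjoint_iter].
have EE y : E y = y - iter k.+1 D y by rewrite /E scale1r scaleN1r.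
have DE y : odd y -> D (E y) = 0.
  move=> y1; have := Dlin (-1) (iter k.+1 D y) y.
  by rewrite !scaleN1r -iterS -qk Dq // addNr addrC -EE.
have EEE y : odd y -> E (E y) = E y.
  by move=> y1; rewrite {1}EE iterSr DE // iter_fix0 // subr0.
apply/eqP; apply: contraNT g_neq0 => Dx0; apply/eqP.
have Eg : E g = 0.
  apply: (selfadjoint_monolith Eself _ (Dodd _ x1) Dx0) => [y y1|]; first by rewrite EEE.
  by rewrite EE -iterSr -qk Dq // subrr.
by move/eqP: Eg; rewrite EE subr_eq0 iterSr Dg iter_fix0 // => /eqP.
Qed.

(** T has an eigenvalue s in F, and T - s again equals its q-th power. *)
Lemma selfadjoint_scalar T : selfadjoint T ->
  (forall x, odd x -> iter #|F| T x = T x) ->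
  exists s, forall x, odd x -> T x = s *: x.
Proof.
move=> Tself Tq; have [Tlin Todd _ _] := Tself.
have oT y t : odd y -> odd (T y - t *: y).
  by move=> y1; apply: componentB; [apply: Todd|apply: componentZ].
have [s [v [v1 v0 Tv]]] := frob_eigenvector Tlin oT Tq g1 g_neq0.
exists s => x x1; pose D y := 1 *: T y + (- s) *: y.
have DE y : D y = T y - s *: y by rewrite /D scale1r scaleNr.
apply/eqP; rewrite -subr_eq0 -DE; apply/eqP.
apply: (selfadjoint_pow_eq0 _ _ v1 v0) => //.
- by apply: selfadjoint_lin => //; apply: selfadjoint_id.
- move=> y y1; rewrite DE -(frob_shift Tlin Tq s y1).
  by elim: (#|F|) => //= k ->; rewrite DE.
- by rewrite DE Tv subrr.
Qed.

Lemma selfadjoint_sq a : even a -> selfadjoint (Rop a \o Rop a).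
Proof.
move=> a0; split=> /=.
- by move=> c x y; rewrite /Rop !lie_linearl.
- by move=> x x1; do 2!apply: lie_odd_even => //.
- by move=> x b x1 b0; rewrite /Rop (lie_evenAC even_lie x b0 a0) (lie_evenAC even_lie _ b0 a0).
- by move=> x y x1 y1; apply: lie_odd_shift2.
Qed.

Lemma sq_scalar a : even a -> exists s, forall x, odd x -> [l [l x, a], a] = s *: x.
Proof.
move=> a0; apply: (selfadjoint_scalar (selfadjoint_sq a0)) => x x1.
have -> k : iter k (Rop a \o Rop a) x = iter k (Rop a) (iter k (Rop a) x).
  by elim: k => [//|k IHk]; rewrite !iterS IHk /= -iterS iterSr.
by rewrite !ad_pow //; apply: lie_odd_even.
Qed.

(** Polarization of [sq_scalar]. *)
Lemma mul_scalar a b : even a -> even b ->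
  exists s, forall x, odd x -> [l [l x, a], b] = s *: x.
Proof.
move=> a0 b0; have [s1 e1] := sq_scalar a0; have [s2 e2] := sq_scalar b0.
have [s3 e3] := sq_scalar (componentD a0 b0).
exists (2^-1 * (s3 - s1 - s2)) => x x1; apply/(scalerI two_neq0).
rewrite scalerA mulrA mulfV // mul1r !scalerBl -e1 // -e2 // -e3 //.
rewrite !lieDr !lieDl (lie_evenAC even_lie x b0 a0).
set A := [l [l x, a], a]; set B := [l [l x, b], b]; set C := [l [l x, a], b].
have -> : A + C + (C + B) = C + C + A + B by rewrite [A + C]addrC addrACA addrA.
by rewrite [RHS]addrAC !addrK scaler_nat mulr2n.
Qed.

(** The scalar a^2 is the square of an eigenvalue of a, and the eigenvalues of
    a are in F; so a can be rescaled to make it 1. *)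
Lemma nonzero_sq_normalize a : even a ->
  (exists2 x, odd x & [l [l x, a], a] != 0) ->
  exists2 h, even h & forall x, odd x -> [l [l x, h], h] = x.
Proof.
move=> a0 [x x1 xaa]; have [s aS] := mul_scalar a0 a0.
have oR y t : odd y -> odd (Rop a y - t *: y).
  by move=> y1; apply: componentB; [apply: lie_odd_even|apply: componentZ].
have Rlin c y z : Rop a (c *: y + z) = c *: Rop a y + Rop a z by exact: lie_linearl.
have [t [v [v1 v0 va]]] :=
  frob_eigenvector Rlin oR (fun y (y1 : odd y) => ad_pow y1 a0) g1 g_neq0.
have st : s = t ^+ 2.
  have /eqP := aS v v1; rewrite -[[l v, a]]/(Rop a v) va lieZl -[[l v, a]]/(Rop a v) va.
  by rewrite scalerA -subr_eq0 -scalerBl scaler_eq0 (negPf v0) orbF subr_eq0 => /eqP <-.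
have t0 : t != 0.
  by apply: contraNneq xaa => t0; rewrite aS // st t0 expr0n scale0r.
exists (t^-1 *: a) => [|y y1]; first exact: componentZ.
by rewrite !lieZr lieZl aS // !scalerA st (_ : _ * _ = 1) ?scale1r //; field.
Qed.

(** If all squares vanish then a = a^q acts as zero, so the even part is zero. *)
Lemma abelian_model : (forall a, even a -> forall x, odd x -> [l [l x, a], a] = 0) ->
  exists a m n, exists A E E' : sl2 F, sl2_model a m n A E E'.
Proof.
move=> sq0; have even0 a : even a -> a = 0.
  have [k qk] : exists k, #|F| = k.+2 by exists #|F|.-2; lia.
  move=> a0; apply: even_faithful => // x x1.
  by rewrite -ad_pow // qk 2!iterSr [Rop a _]sq0 // iter_fix0 ?Rop0.
exists 0, g, 0, (sl2_of 0 0 0), (sl2_of 0 1 0), (sl2_of 0 0 0); split.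
- exists 0, 0; split; split; rewrite ?oppr0 ?scale0r ?lie0l ?lie0r //;
    by apply: sl2_eq; rewrite !sl2E !sl2_ofE; ring.
- by split => //; apply: component0.
- by split; [apply: sl2_of_even|apply: sl2_of_odd|apply: sl2_of_odd].
- split=> x xd; first by exists 0; rewrite scaler0; apply: even0.
  have [->|x0] := eqVneq x 0; first by exists 0, 0; rewrite !scale0r addr0.
  have [y|k gE] := monolith_line xd _ x0.
    have [y0 [y1 [/even0 -> h1 ->]]] := component_sum y.
    by exists 0; rewrite scale0r add0r; apply/even0/lie_odd_odd.
  have k0 : k != 0 by apply: contraNneq g_neq0 => k0; rewrite gE k0 scale0r.
  by exists k^-1, 0; rewrite gE scalerA mulVf // scale1r scale0r addr0.
- move=> k /(congr1 (fun X : sl2 F => X 0 1)).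
  have [_ -> _] := lincomb_sl2 0 1 0 k; rewrite sl2_0E mulr1 /lincomb => ->.
  by rewrite !scaler0 scale0r !addr0.
Qed.

Section SplitTorus.
Variable h : N.
Hypothesis h0 : even h.
Hypothesis hh : forall x, odd x -> [l [l x, h], h] = x.

(** The product h b is a scalar k on odd elements and h^2 = 1, so b acts as k h. *)
Lemma torus_even b : even b -> exists k, b = k *: h.
Proof.
move=> b0; have [k hb] := mul_scalar h0 b0; exists k; apply/eqP; rewrite -subr_eq0.
apply/eqP/even_faithful => [|x x1]; first by apply: componentB; rewrite //; apply: componentZ.
by rewrite lieBr lieZr -{1}[x]hh // hb ?subrr //; apply: lie_odd_even.
Qed.

Lemma torus_split x : odd x -> exists u v,
  [/\ odd u, odd v, [l u, h] = u, [l v, h] = - v & x = u + v].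
Proof.
move=> x1; have xh : odd [l x, h] by apply: lie_odd_even.
exists (2^-1 *: (x + [l x, h])), (2^-1 *: (x - [l x, h])); split.
- exact/componentZ/componentD.
- exact/componentZ/componentB.
- by rewrite lieZl lieDl hh // addrC.
- by rewrite lieZl lieBl hh // -scalerN opprB.
- rewrite -scalerDr addrACA subrr addr0 -mulr2n -scaler_nat scalerA mulVf //.
  by rewrite scale1r.
Qed.

Lemma same_sign_lie0 u v s : s != 0 -> odd u -> odd v ->
  [l u, h] = s *: u -> [l v, h] = s *: v -> [l u, v] = 0.
Proof.
move=> s0 u1 v1 uh vh; have := lie_lier u v h.
rewrite uh vh lieZl lieZr (even_lie (lie_odd_odd u1 v1) h0) -mulr2n -scaler_nat.
move=> /esym/eqP; rewrite !scaler_eq0 (negPf s0) (negPf two_neq0) => /eqP //.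
Qed.

(** Brackets of odd elements are multiples of h, so the Jacobi identity for m, n and
    a further eigenvector of h makes that eigenvector a multiple of m or of n. *)
Lemma sl2_full_model m n : odd m -> odd n -> [l m, h] = m -> [l n, h] = - n ->
  [l m, n] != 0 -> exists a m n, exists A E E' : sl2 F, sl2_model a m n A E E'.
Proof.
move=> m1 n1 mh nh mn0; have [b mn] := torus_even (lie_odd_odd m1 n1).
have b0 : b != 0 by apply: contraNneq mn0 => b0; rewrite mn b0 scale0r.
have hm x : [l h, x] = - [l x, h] by exact: lieC.
have colM x : odd x -> [l x, h] = x -> exists k, x = k *: m.
  move=> x1 xh; have mx : [l m, x] = 0.
    by apply: (@same_sign_lie0 _ _ 1); rewrite ?oner_neq0 // ?mh ?xh scale1r.
  have [k nx] := torus_even (lie_odd_odd n1 x1).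
  have := lie_lier m n x; rewrite mx lie0l add0r mn nx lieZl lieZr hm xh mh scalerN.
  move=> e; exists (- (k / b)); apply: (scalerI b0); rewrite scalerA mulrN mulrC divfK //.
  by rewrite scaleNr -e opprK.
have colN x : odd x -> [l x, h] = - x -> exists k, x = k *: n.
  move=> x1 xh; have nx : [l n, x] = 0.
    by apply: (@same_sign_lie0 _ _ (-1)); rewrite ?oppr_eq0 ?oner_neq0 // ?nh ?xh scaleN1r.
  have [k mx] := torus_even (lie_odd_odd m1 x1).
  have := lie_lier m n x; rewrite nx lie0r addr0 mn mx !lieZl !hm xh nh !opprK.
  move=> e; exists (k / b); apply: (scalerI b0); rewrite scalerA mulrC divfK //.
exists h, m, n, (sl2_of (- 2^-1) 0 0), (sl2_of 0 1 0), (sl2_of 0 0 (- (b / 2))); split.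
- exists 1, b; split; last exact: sl2_table.
  by split; rewrite ?scaleN1r ?scale1r.
- by [].
- by split; [apply: sl2_of_even|apply: sl2_of_odd|apply: sl2_of_odd].
- split=> x xd; first exact: torus_even.
  have [u [v [u1 v1 /(colM _ u1)[k ->] /(colN _ v1)[k' ->] ->]]] := torus_split xd.
  by exists k, k'.
- move=> k kX; have [e0 e1 e2] := lincomb_sl2 (- 2^-1) 1 (- (b / 2)) k.
  move: e0 e1 e2; rewrite kX !sl2_0E => /esym/eqP + /esym/eqP + /esym/eqP.
  rewrite !mulf_eq0 !oppr_eq0 mulf_eq0 !invr_eq0 (negPf two_neq0) (negPf b0) oner_eq0 !orbF.
  by rewrite /lincomb => /eqP -> /eqP -> /eqP ->; rewrite !scale0r !addr0.
Qed.

(** When the odd part is abelian every eigenvector of h spans an ideal, hence is a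
    multiple of g. *)
Lemma borel_model : (forall u v, odd u -> odd v -> [l u, v] = 0) ->
  [l g, h] = g -> exists a m n, exists A E E' : sl2 F, sl2_model a m n A E E'.
Proof.
move=> odd0 gh.
have eigen_line s u : odd u -> [l u, h] = s *: u -> u != 0 -> exists k, g = k *: u.
  move=> u1 uh; apply: (monolith_line u1) => y.
  have [y0 [y1 [/torus_even[k ->] h1 ->]]] := component_sum y.
  by exists (k * s); rewrite lieDr (odd0 _ _ u1 h1) addr0 lieZr uh scalerA.
exists h, g, 0, (sl2_of (- 2^-1) 0 0), (sl2_of 0 1 0), (sl2_of 0 0 0); split.
- exists 1, 0; split; first by split; rewrite ?gh ?scale1r ?scaleN1r ?lie0l ?lie0r ?oppr0 ?scale0r.
  by have := sl2_table 0 two_neq0; rewrite mul0r oppr0.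
- by split=> //; apply: component0.
- by split; [apply: sl2_of_even|apply: sl2_of_odd|apply: sl2_of_odd].
- split=> x xd; first exact: torus_even.
  have [u [v [u1 v1 uh vh ->]]] := torus_split xd.
  have -> : v = 0.
    apply/eqP; apply: contraNT g_neq0 => v0.
    have [|k gE] := eigen_line (-1) v v1 _ v0; first by rewrite scaleN1r.
    move/eqP: gh; rewrite {1}gE lieZl vh scalerN -gE eq_sym -addr_eq0 -mulr2n -scaler_nat.
    by rewrite scaler_eq0 (negPf two_neq0).
  have [->|u0] := eqVneq u 0; first by exists 0, 0; rewrite !scale0r.
  have [|k gE] := eigen_line 1 u u1 _ u0; first by rewrite scale1r.
  have k0 : k != 0 by apply: contraNneq g_neq0 => k0; rewrite gE k0 scale0r.
  by exists k^-1, 0; rewrite gE scalerA mulVf // scale1r scaler0.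
- move=> k kX; have [e0 e1 _] := lincomb_sl2 (- 2^-1) 1 0 k.
  move: e0 e1; rewrite kX !sl2_0E => /esym/eqP + /esym/eqP.
  rewrite !mulf_eq0 oppr_eq0 invr_eq0 (negPf two_neq0) oner_eq0 !orbF.
  by rewrite /lincomb => /eqP -> /eqP ->; rewrite !scale0r scaler0 !addr0.
Qed.

End SplitTorus.

Lemma monolith_model : exists a m n, exists A E E' : sl2 F, sl2_model a m n A E E'.
Proof.
have [sq0|/existsNP[a /not_implyP[a0 /existsNP[x /not_implyP[x1 /eqP xaa]]]]] :=
  pselect (forall a, even a -> forall x, odd x -> [l [l x, a], a] = 0).
  exact: abelian_model.
have [h h0 hh] := nonzero_sq_normalize a0 (ex_intro2 _ _ x x1 xaa).
have [ab|/existsNP[u /existsNP[v]]] := pselect (forall u v, odd u -> odd v ->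
  [l u, h] = u -> [l v, h] = - v -> [l u, v] = 0); last first.
  move=> /not_implyP[u1 /not_implyP[v1 /not_implyP[uh /not_implyP[vh /eqP uv]]]].
  exact: (sl2_full_model h0 hh u1 v1 uh vh uv).
have odd0 u v : odd u -> odd v -> [l u, v] = 0.
  move=> u1 v1; have [u' [u'' [u'1 u''1 uh' uh'' ->]]] := torus_split h0 hh u1.
  have [v' [v'' [v'1 v''1 vh' vh'' ->]]] := torus_split h0 hh v1.
  rewrite lieDl !lieDr [[l u'', v']]lieC (ab u' v'') // (ab v' u'') // oppr0 addr0.
  rewrite add0r (same_sign_lie0 h0 (oner_neq0 F) u'1 v'1) ?scale1r // add0r.
  by apply: (@same_sign_lie0 h h0 _ _ (-1)); rewrite ?oppr_eq0 ?oner_neq0 ?scaleN1r.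
(* g lies in one of the two eigenspaces; up to replacing h by - h the eigenvalue is 1. *)
have [k kh gh] : exists2 k, k = h \/ k = - h & [l g, k] = g.
  have [u [v [u1 v1 uh vh gE]]] := torus_split h0 hh g1.
  have col s w : odd w -> [l w, h] = s *: w -> w != 0 -> [l g, h] = s *: g.
    move=> w1 wh w0; have [y|k gk] := monolith_line w1 _ w0.
      have [y0 [y1 [/(torus_even h0 hh)[k ->] h1 ->]]] := component_sum y.
      by exists (k * s); rewrite lieDr (odd0 _ _ w1 h1) addr0 lieZr wh scalerA.
    by rewrite gk lieZl wh !scalerA mulrC.
  have [u0|u0] := eqVneq u 0.
    exists (- h); first by right.
    rewrite lieNr (col (-1) v) ?scaleN1r ?opprK //.
    by apply: contraNneq g_neq0 => v0; rewrite gE u0 v0 addr0.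
  by exists h; [left|rewrite (col 1 u) ?scale1r].
have [k0 kk] : even k /\ forall y, odd y -> [l [l y, k], k] = y.
  case: kh => -> //; split=> [|y y1]; first exact: componentN.
  by rewrite !lieNr lieNl opprK hh.
exact: borel_model k0 kk odd0 gh.
Qed.

End Monolith.

(** * Verbal hulls and maximal ideals *)

(** All terms of [Sem2] but the first involve at least three factors. *)
Lemma Sem2_nil2 (F : fieldType) (L : lieAlgType F) q (x y : L) : (3 < q)%N ->
  [l [l x, y], x] = 0 -> [l [l x, y], y] = 0 -> Sem2 q x y = [l x, y].
Proof.
move=> q3 cx cy; set c := [l x, y] in cx cy *.
have [k qk] : exists k, q = k.+3 by exists (q - 3)%N; lia.
have [K q2] : exists K, (q ^ 2 = K.+3)%N by exists (q ^ 2 - 3)%N; rewrite qk; nia.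
have D0 a : frob_defect q a 0 = 0 :> L by rewrite /frob_defect iter_fix0 !Rop0 ?subrr.
have xc n : iter n.+1 (Rop x) c = 0 by rewrite iterSr [Rop x c]cx iter_fix0 ?Rop0.
have yx n : iter n.+2 (Rop y) x = 0 by rewrite 2!iterSr [Rop y (Rop y x)]cy iter_fix0 ?Rop0.
have Dxc : frob_defect q x c = 0 by rewrite /frob_defect q2 xc [Rop x c]cx subrr.
have Dxy : frob_defect q x y = c.
  have yx' : Rop x y = 0 - c by rewrite sub0r; exact: lieC.
  rewrite /frob_defect q2 iterSr yx' iter_RopB xc iter_fix0 ?Rop0 //.
  by rewrite subr0 !sub0r opprK.
have Wy : frob_defect_comm q x y y = 0.
  by rewrite /frob_defect_comm Dxy [Rop y c]cy [Rop y y]liexx D0 subrr.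
have W0 : frob_defect_comm q x y 0 = 0.
  by rewrite /frob_defect_comm D0 !Rop0 D0 subrr.
have Wq : iter q (frob_defect_comm q x y) y = 0.
  by rewrite [X in iter X]qk iterSr Wy iter_fix0.
have yxq : iter q (Rop y) x = 0 by rewrite qk yx.
rewrite Sem2E -/c Wq Dxc yxq q2 subn1 xc.
by rewrite !iter_fix0 ?Rop0 // D0 !subr0 !addr0.
Qed.

Section Hull.
Variable F : fieldType.
Local Notation L := (freeLie F).

Lemma verbal_hull_ideal (S : set L) : is_graded_verbal_ideal (graded_verbal_hull S).
Proof.
have sub M : is_graded_verbal_ideal M /\ S `<=` M -> graded_verbal_hull S `<=` M.
  by move=> MP x; apply.
split; first split.
- split=> [M [[MI _] _]|a x y hx hy M MP]; first exact: (ideal0 MI).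
  by apply: (ideal_lin MP.1.1); apply: sub.
- move=> x y hx; split=> M MP; [apply: (ideal_liel MP.1.1)|apply: (ideal_lier MP.1.1)];
    exact: sub.
- move=> x0 x1 h0 h1 hx.
  have hM M : is_graded_verbal_ideal M /\ S `<=` M -> M x0 /\ M x1.
    by move=> MP; case: MP.1.1 => _ _; apply => //; apply: sub.
  by split=> M MP; have [] := hM M MP.
- by move=> phi hphi f hf M MP; apply: MP.1.2 => //; apply: sub.
Qed.

Lemma preimage_graded_ideal (M N : gradedLieType F) (phi : M -> N) (K : set N) :
  is_graded_hom phi -> is_graded_ideal K -> is_graded_ideal (phi @^-1` K).
Proof.
move=> [hphi gphi] KI; split.
- split=> [|a x y Kx Ky] /=; first by rewrite (lie_hom0 hphi); apply: ideal0 KI.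
  by rewrite hphi.1; apply: (ideal_lin KI).
- move=> x y Kx /=; rewrite !hphi.2.
  by split; [apply: (ideal_liel KI)|apply: (ideal_lier KI)].
- move=> x0 x1 h0 h1 /=; rewrite (lie_homD hphi).
  by case: KI => _ _; apply; apply: gphi.
Qed.

Lemma lpi_graded (M : gradedLieType F) (J : set M) (JI : is_graded_ideal J) :
  is_graded_hom (lpi JI).
Proof. by split=> [|g x]; [exact: lpi_hom|exact: lpi_component]. Qed.

(** Zorn, applied to the sets K such that the union of I and K is a graded ideal
    avoiding f; this form admits the empty chain. *)
Lemma maximal_avoiding_ideal (M : gradedLieType F) (I : set M) f :
  is_graded_ideal I -> ~ I f -> exists J : set M,
    [/\ is_graded_ideal J, I `<=` J, ~ J f &
        forall K x, is_graded_ideal K -> J `<=` K -> K x -> ~ J x -> K f].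
Proof.
move=> II If.
pose P (K : set M) := is_graded_ideal (I `|` K) /\ ~ (I `|` K) f.
have [C CP Ctot|A [[AI Af] Amax]] := @Zorn_bigcup M P.
  rewrite /P; set U := I `|` _.
  have pair x y : U x -> U y -> exists K,
      [/\ is_graded_ideal K, K `<=` U, K x & K y].
    have sub K : C K -> I `|` K `<=` U.
      by move=> CK z [|Kz]; [left|right; exists K].
    move=> [Ix|[K1 CK1 Kx]] [Iy|[K2 CK2 Ky]].
    - by exists I; split=> // z; left.
    - by exists (I `|` K2); split; [exact: (CP _ CK2).1|exact: sub|left|right].
    - by exists (I `|` K1); split; [exact: (CP _ CK1).1|exact: sub|right|left].
    - have [K12|K21] := Ctot _ _ CK1 CK2.
        exists (I `|` K2); split; [exact: (CP _ CK2).1|exact: sub|right; exact: K12|by right].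
      exists (I `|` K1); split; [exact: (CP _ CK1).1|exact: sub|by right|right; exact: K21].
  split; last by move=> [//|[K CK Kf]]; apply: (CP _ CK).2; right.
  split.
  - split=> [|a x y Ux Uy]; first by left; apply: ideal0 II.
    have [K [KI KU Kx Ky]] := pair _ _ Ux Uy.
    by apply: KU; apply: (ideal_lin KI).
  - move=> x y Ux; have [K [KI KU Kx _]] := pair _ _ Ux Ux.
    by split; apply: KU; [apply: (ideal_liel KI)|apply: (ideal_lier KI)].
  - move=> x0 x1 h0 h1 Ux; have [K [KI KU Kx _]] := pair _ _ Ux Ux.
    by case: KI => _ _ /(_ _ _ h0 h1 Kx) [K0 K1]; split; apply: KU.
exists (I `|` A); split=> // K x KI AK Kx nAx.
have IK : I `<=` K by move=> z Iz; apply: AK; left.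
have AK' : A `<=` K by move=> z Az; apply: AK; right.
apply: contrapT => nKf; apply: (Amax K); first split=> //.
  by move=> KA; apply: nAx; right; apply: KA.
by rewrite /P; have /setUidPr -> := IK.
Qed.

Lemma quot_monolith (M : gradedLieType F) (J : set M) (JI : is_graded_ideal J) f :
  (forall K x, is_graded_ideal K -> J `<=` K -> K x -> ~ J x -> K f) ->
  forall (K : set (lieQuot JI)) u, is_graded_ideal K -> K u -> u != 0 -> K (lpi JI f).
Proof.
move=> Jmax K u KI; elim/lpiW: u => x Kx x0.
have preI := preimage_graded_ideal (lpi_graded JI) KI.
apply: (Jmax _ x preI) => // [y Jy|Jx] /=.
  by rewrite (lpi_eq0 JI y).2 //; apply: ideal0 KI.
by move/eqP: x0; apply; apply/lpi_eq0.
Qed.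

End Hull.

(** * The four polynomials generate the identities of sl2 *)

Definition basis_subst (F : fieldType) (N : gradedLieType F) (a b m n : N) (v : gvar) : N :=
  match v with
  | EvenVar i => if i == 1%N then a else if i == 2%N then b else 0
  | OddVar i => if i == 1%N then m else if i == 2%N then n else 0
  end.

Lemma basis_subst_graded (F : fieldType) (N : gradedLieType F) (a b m n : N) :
  component 0 a -> component 0 b -> component 1 m -> component 1 n ->
  graded_subst (basis_subst a b m n).
Proof.
by move=> a0 b0 m1 n1 [] i /=; case: ifP => // _; case: ifP => // _; apply: component0.
Qed.

Section Variety.
Variables (F : finFieldType) (N : gradedLieType F).
Hypothesis NB : sl2_basis F `<=` graded_identities N.
Local Notation even := (@component F N 0).
Local Notation odd := (@component F N 1).

Lemma basis_even_lie a b : even a -> even b -> [l a, b] = 0.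
Proof.
move=> a0 b0; have sP := basis_subst_graded a0 b0 (component0 N 1) (component0 N 1).
have := NB (or_introl (or_introl (or_introl erefl))) sP.
by rewrite (eval_lie_hom _).2 !eval_gen.
Qed.

Lemma basis_ad_pow m a : odd m -> even a -> iter #|F| (Rop a) m = [l m, a].
Proof.
move=> m1 a0; have sP := basis_subst_graded a0 (component0 N 0) m1 (component0 N 1).
have := NB (or_intror erefl) sP.
have hs := eval_lie_hom (basis_subst a 0 m 0).
rewrite (lie_homB hs) (lie_hom_iter_Rop hs) hs.2 !eval_gen /=.
by move=> /eqP; rewrite subr_eq0 => /eqP.
Qed.

Lemma basis_nil2_abelian m n : (3 < #|F|)%N -> odd m -> odd n ->
  [l [l m, n], m] = 0 -> [l [l m, n], n] = 0 -> [l m, n] = 0.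
Proof.
move=> q3 m1 n1 cm cn; rewrite -(Sem2_nil2 q3 cm cn).
have sP := basis_subst_graded (component0 N 0) (component0 N 0) m1 n1.
have := NB (or_introl (or_intror erefl)) sP.
have hs := eval_lie_hom (basis_subst 0 0 m n).
by rewrite (lie_hom_Sem2 hs) !(lie_homD hs) !eval_gen /= !add0r.
Qed.

End Variety.

Section Main.
Variable F : finFieldType.
Local Notation q := #|F|.
Local Notation L := (freeLie F).
Hypothesis two_neq0 : (2 : F) != 0.
Hypothesis q_odd : odd q.
Hypothesis q_gt3 : (3 < q)%N.

Lemma card_gt1 : (1 < q)%N. Proof. exact: leq_trans q_gt3. Qed.

Lemma sl2_even_lie (a b : sl2 F) : component 0 a -> component 0 b -> [l a, b] = 0.
Proof.
move=> /is_diag_mxP ad /is_diag_mxP bd.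
by apply: sl2_eq; rewrite !sl2E ?(ad 0 1) ?(ad 1 0) ?(bd 0 1) ?(bd 1 0) //; ring.
Qed.

Lemma sl2_ad_pow (m a : sl2 F) : component 1 m -> component 0 a ->
  iter q (Rop a) m = [l m, a].
Proof.
move=> m1 /is_diag_mxP ad.
have m00 : m 0 0 = 0 by exact: (m1 0).
have a01 : a 0 1 = 0 by rewrite ad.
have a10 : a 1 0 = 0 by rewrite ad.
have aa : trform a a = (2 * a 0 0) ^+ 2 by rewrite /trform a01 a10; ring.
have := odd_double_half q; rewrite q_odd add1n => qk; rewrite -qk iter_Rop_odd.
have [a0|a0] := eqVneq (a 0 0) 0.
  have -> : a = 0 by apply: sl2_eq; rewrite sl2_0E.
  by rewrite /Rop lie0r scaler0.
have b0 : 2 * a 0 0 != 0 by rewrite mulf_neq0.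
rewrite aa -exprM mul2n (_ : _ ^+ _ = 1) ?scale1r //.
by apply: (mulfI b0); rewrite -exprS qk expf_card mulr1.
Qed.

Lemma basis_sl2 : sl2_basis F `<=` graded_identities (sl2 F).
Proof.
move=> _ [[[->|->]|->]|->] s sP; have hs := eval_lie_hom s.
- rewrite hs.2 !eval_gen; apply: sl2_even_lie.
    exact: (sP (EvenVar 1)).
  exact: (sP (EvenVar 2)).
- by rewrite (lie_hom_Sem1 hs) Sem1_sl2.
- by rewrite (lie_hom_Sem2 hs) Sem2_sl2.
- rewrite (lie_homB hs) (lie_hom_iter_Rop hs) hs.2 !eval_gen sl2_ad_pow ?subrr //.
    exact: (sP (OddVar 1)).
  exact: (sP (EvenVar 1)).
Qed.

Let I : set L := graded_verbal_hull (sl2_basis F).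
Let IV : is_graded_verbal_ideal I. Proof. exact: verbal_hull_ideal. Qed.

Lemma basis_quot (J : set L) (JI : is_graded_ideal J) :
  I `<=` J -> sl2_basis F `<=` graded_identities (lieQuot JI).
Proof.
move=> IJ f Sf; apply: (verbal_quot_identities IV IJ) => M [_].
by apply.
Qed.

(** Otherwise the quotient by a maximal graded ideal avoiding f would embed in sl2
    with f not mapped to zero. *)
Lemma odd_identity_hull f :
  component 1 f -> graded_identities (sl2 F) f -> I f.
Proof.
move=> f1 fid; apply: contrapT => nIf.
have [J [JI IJ nJf Jmax]] := maximal_avoiding_ideal IV.1 nIf.
have NB := @basis_quot J JI IJ.
have mono := @quot_monolith F _ J JI f Jmax.
have g1 : component 1 (lpi JI f) by apply: lpi_component.
have g0 : lpi JI f != 0 by apply/eqP => /lpi_eq0.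
have [a [m [n [A [E [E' mod]]]]]] := monolith_model two_neq0 card_gt1
  (basis_even_lie NB) (basis_ad_pow NB) g1 g0 mono.
have [s [sP skill]] := sl2_model_subst mod (lpi_graded JI).
by case/eqP: g0; apply: skill; apply: fid.
Qed.

Definition y_point (i : nat) (v : gvar) : sl2 F :=
  if v is EvenVar j then if j == i then sl2_of 1 0 0 else 0 else 0.

Lemma y_point_graded i : graded_subst (y_point i).
Proof.
by case=> j /=; [case: ifP => _; [apply: sl2_of_even|apply: component0]|apply: component0].
Qed.

Definition y_coef (i : nat) (f : L) : F := eval (y_point i) f 0 0.

Lemma y_point_odd i f : component 1 f -> eval (y_point i) f = 0.
Proof.
suff H d : fcomponent d f -> d = 1 -> eval (y_point i) f = 0 by move=> /H; apply.
have hs := eval_lie_hom (y_point i).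
elim=> {d f} [[] j //= _|//|d a f1 f2 _ E1 _ E2 d1|d e f1 f2 _ E1 _ E2 de].
- by rewrite eval_gen.
- by rewrite (lie_hom0 hs).
- by rewrite hs.1 E1 // E2 // scaler0 addr0.
- rewrite hs.2; case: (Z2P d) de => [d0|/E1 ->]; last by rewrite lie0l.
  by rewrite d0 add0r => /E2 ->; rewrite lie0r.
Qed.

(** Modulo the vanishing brackets of even elements, an even element is its linear part
    in the even variables plus brackets of odd elements; the linear coefficients are
    values at points of sl2.  The bound n0 lets the linear part be written with any
    large enough number of variables, so that sums can be added. *)
Lemma even_normal_form (J : set L) (JI : is_graded_ideal J) f :
  (forall a b : lieQuot JI, component 0 a -> component 0 b -> [l a, b] = 0) ->
  component 0 f ->
  exists n0 (s : seq (lieQuot JI * lieQuot JI)),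
    (forall p, p \in s -> component 1 p.1 /\ component 1 p.2) /\
    forall n, (n0 <= n)%N ->
    lpi JI f = \sum_(i < n) y_coef i f *: lpi JI (gen F (EvenVar i))
             + \sum_(p <- s) [l p.1, p.2].
Proof.
move=> ev; suff H d : fcomponent d f -> d = 0 -> exists n0 (s : seq (lieQuot JI * lieQuot JI)),
    (forall p, p \in s -> component 1 p.1 /\ component 1 p.2) /\
    forall n, (n0 <= n)%N ->
    lpi JI f = \sum_(i < n) y_coef i f *: lpi JI (gen F (EvenVar i))
             + \sum_(p <- s) [l p.1, p.2] by move=> /H; apply.
have hpi := lpi_hom JI.
elim=> {d f} [[] j //= _|d _|d a f1 f2 _ E1 _ E2 d0|d e f1 f2 df1 _ ef2 _ de].
- exists j.+1, [::]; split=> // n jn; rewrite big_nil addr0.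
  rewrite (bigD1 (Ordinal jn)) //= big1 => [|i ij].
    by rewrite /y_coef eval_gen /= eqxx sl2_of00 scale1r addr0.
  rewrite /y_coef eval_gen /= ifF ?sl2_0E ?scale0r //.
  by apply/negbTE; rewrite eq_sym.
- exists 0%N, [::]; split=> // n _; rewrite big_nil addr0 (lie_hom0 hpi) big1 // => i _.
  by rewrite /y_coef (lie_hom0 (eval_lie_hom _)) sl2_0E scale0r.
- have [n1 [s1 [s1P e1]]] := E1 d0; have [n2 [s2 [s2P e2]]] := E2 d0.
  exists (maxn n1 n2), ([seq (a *: p.1, p.2) | p <- s1] ++ s2); split.
    move=> p; rewrite mem_cat => /orP[/mapP[r /s1P[r1 r2] ->]|/s2P//].
    by split=> //; apply: componentZ.
  move=> n; rewrite geq_max => /andP[n1n n2n]; rewrite hpi.1 (e1 n) // (e2 n) //.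
  rewrite scalerDr addrACA big_cat big_map !scaler_sumr -big_split /=.
  congr (_ + (_ + _)); apply: eq_bigr => i _; last by rewrite lieZl.
  by rewrite /y_coef (eval_lie_hom _).1 sl2_addE sl2_scaleE scalerDl scalerA.
- have coef0 i : y_coef i [l f1, f2] = 0.
    rewrite /y_coef (eval_lie_hom _).2; have [_ gs] := eval_graded (@y_point_graded i).
    case: (Z2P d) df1 => -> df1; last by rewrite (y_point_odd i df1) lie0l sl2_0E.
    case: (Z2P e) ef2 => -> ef2; last by rewrite (y_point_odd i ef2) lie0r sl2_0E.
    by rewrite (sl2_even_lie (gs _ _ df1) (gs _ _ ef2)) sl2_0E.
  have sum0 n : \sum_(i < n) y_coef i [l f1, f2] *: lpi JI (gen F (EvenVar i)) = 0.
    by rewrite big1 // => i _; rewrite coef0 scale0r.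
  case: (Z2P d) df1 de => -> df1 de.
    move: de ef2; rewrite add0r => -> ef2.
    exists 0%N, [::]; split=> // n _; rewrite sum0 big_nil addr0 hpi.2.
    by apply: ev; apply: lpi_component.
  case: (Z2P e) ef2 de => -> ef2 //.
  exists 0%N, [:: (lpi JI f1, lpi JI f2)]; split=> [p|n _].
    by rewrite inE => /eqP -> /=; split; apply: lpi_component.
  by rewrite sum0 big_seq1 add0r hpi.2.
Qed.

(** The linear coefficients of an identity vanish, and an identity is central modulo
    the hull by the odd case. *)
Lemma even_identity_hull f :
  component 0 f -> graded_identities (sl2 F) f -> I f.
Proof.
move=> f0 fid; have II := IV.1; have NB := @basis_quot I II (fun x Ix => Ix).
have ev := basis_even_lie NB.
have [n0 [s [sP /(_ n0 (leqnn _)) fE]]] := even_normal_form ev f0.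
have {}fE : lpi II f = \sum_(p <- s) [l p.1, p.2].
  rewrite fE big1 ?add0r // => i _.
  by rewrite /y_coef fid ?sl2_0E ?scale0r //; apply: y_point_graded.
have [k qk] : exists k, q = k.+1.*2.+1.
  by exists q./2.-1; have := odd_double_half q; rewrite q_odd; lia.
apply/lpi_eq0; rewrite -/II fE.
apply: (central_derived_eq0 two_neq0 ev (k := k)) => // [m a|m n|u].
- by rewrite -qk; apply: basis_ad_pow.
- exact: basis_nil2_abelian.
- rewrite -fE => -[z z1 ->]; rewrite -(lpi_hom II).2; apply/lpi_eq0.
  apply: odd_identity_hull; first exact: lie_even_odd.
  have [[_ idl _] _] := identities_verbal (sl2 F).
  by have [] := idl _ z fid.
Qed.

End Main.

Theorem theorem5p1 (F : finFieldType) (p : nat)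
    (charF : p \in [pchar F]) (p_gt3 : (3 < p)%N) :
  graded_identities (sl2 F) = graded_verbal_hull (sl2_basis F).
Proof.
have p_pr := pcharf_prime charF.
have p_odd : odd p by case: (even_prime p_pr) => // p2; move: p_gt3; rewrite p2.
have two_neq0 : (2 : F) != 0.
  rewrite -(dvdn_pcharf charF); apply/negP => /dvdn_leq => /(_ isT).
  by rewrite leqNgt (ltn_trans _ p_gt3).
have pq : p.-nat #|F|.
  by rewrite -cardsT; apply/abelem_pgroup/fin_ring_pchar_abelem.
have [k qk] := p_natP pq.
have k0 : (0 < k)%N.
  by rewrite lt0n; apply: contra_eq_neq qk => ->; rewrite neq_ltn card_finRing_gt1 orbT.
have q_odd : odd #|F| by rewrite qk oddX p_odd orbT.
have q_gt3 : (3 < #|F|)%N.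
  by rewrite qk (leq_trans p_gt3) // -{1}[p]expn1 leq_pexp2l // prime_gt0.
apply/seteqP; split=> f; last first.
  by apply; split; [exact: identities_verbal|exact: basis_sl2].
move=> fid; have [f0 [f1 [h0 h1 fE]]] := component_sum f.
have [[_ _ idg] _] := identities_verbal (sl2 F).
have [id0 id1] : graded_identities (sl2 F) f0 /\ graded_identities (sl2 F) f1.
  by apply: idg => //; rewrite -fE.
rewrite fE; apply: (idealD (verbal_hull_ideal _).1).
  exact: even_identity_hull.
exact: odd_identity_hull.
Qed.
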